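(* For every one of the $950$ (pairwise nonisomorphic) simple matroids $M$ on eight elements, with $r$ the rank of $M$, the polynomial $H_{\beta,M}$ is strictly log-concave, i.e. \[ h_k^\beta(M)^2>h_{k-1}^\beta(M)\,h_{k+1}^\beta(M)\qquad(1\le k\le r-1), \] and \[ h_k^\beta(M)\ge h_{r-k}^\beta(M)\qquad(0\le k\le r/2). \] Moreover $H_{\beta,M}\ne H_M^0$ for exactly $894$ of these $950$ matroids.
   Context: The $950$ matroids are the complete list, up to isomorphism, of simple matroids on eight elements (Mayhew–Royle catalogue). Let $M$ be a simple matroid of rank $r$ on a finite ground set $E$, and let $L=L(M)$ be its lattice of flats, a geometric lattice with rank function $\mathrm{rk}$, bottom $\hat 0$, top $\hat 1$, and atom set $A$ (identified with $E$). $L_k$ is the set of flats of rank $k$. $\mathbb R[L]$ is the real vector space with basis $(e_x)_{x\in L}$. For an atom $a$, the linear operator $L_a$ on $\mathbb R[L]$ is $L_ae_x=e_{x\vee a}$ if $a\not\le x$, and $L_ae_x=0$ if $a\le x$. For $x\in L_k$, $\beta_x$ is the number of ordered atom bases of $x$, i.e. of tuples $(a_1,\dots,a_k)\in A^k$ with $a_1\vee\dots\vee a_k=x$ (so $\beta_{\hat 0}=1$). Put $v_k=\sum_{x\in L_k}\beta_xe_x$; in particular $v_r=\beta_{\hat 1}e_{\hat 1}$. Equip $\mathbb R[L]$ with the inner product $\langle e_x,e_y\rangle_\beta=\delta_{x,y}/\beta_x$ and let $L_a^\beta$ be the adjoint of $L_a$ for it. Put $U^\beta=\sum_{a\in A}L_a^\beta$,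 $Ke_x=\mathrm{rk}(x)e_x$, $s(x)=|A|-|\{a\in A:a\le x\}|$, and $S^{-1}e_x=s(x)^{-1}e_x$ for $x<\hat 1$, $S^{-1}e_{\hat 1}=0$. Define $D_\beta=S^{-1}U^\beta K$. Define $\mathcal C_0^\beta(M)=\mathbb R v_r$ and $\mathcal C_{k+1}^\beta(M)=D_\beta\mathcal C_k^\beta(M)+\sum_{a\in A}L_a^\beta\mathcal C_k^\beta(M)$; put $h_k^\beta(M)=\dim\mathcal C_k^\beta(M)$ and $H_{\beta,M}(q)=\sum_{k=0}^rh_k^\beta(M)q^k$. Define $\mathcal C_k^0(M)=\mathrm{span}\{L_{a_k}^\beta\cdots L_{a_1}^\beta v_r:a_1,\dots,a_k\in E\}$, $h_k^0(M)=\dim\mathcal C_k^0(M)$ and $H_M^0(q)=\sum_{k=0}^rh_k^0(M)q^k$. *)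

(* Defs.v *)
From HB Require Import structures.
From mathcomp Require Import all_boot all_order all_algebra.

Set Implicit Arguments.
Unset Strict Implicit.
Unset Printing Implicit Defensive.

Import Order.TTheory GRing.Theory Num.Theory.

(** * Matroids on a finite ground set *)

Record matroid (E : finType) := Matroid {
  indep : {set {set E}};
  indep0 : set0 \in indep;
  indepS : forall I J : {set E}, I \subset J -> J \in indep -> I \in indep;
  indep_aug : forall I J : {set E}, I \in indep -> J \in indep -> #|I| < #|J| ->
    exists2 x, x \in J :\: I & x |: I \in indep
}.

Section Matroid.
Variables (E : finType) (M : matroid E).
Implicit Types (x : E) (A B I J : {set E}).

Definition rk A : nat := \max_(I in indep M | I \subset A) #|I|.

Definition matroid_rank : nat := rk setT.

Definition mclosure A : {set E} := [set x | rk (x |: A) == rk A].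

Definition is_flat A : bool := mclosure A == A.

Definition loopless : bool := [forall x, [set x] \in indep M].

Definition no_parallel : bool :=
  [forall x, forall y, (x != y) ==> ([set x; y] \in indep M)].

Definition simple_matroid : bool := loopless && no_parallel.

Lemma leq_rk I A : I \in indep M -> I \subset A -> #|I| <= rk A.
Proof. by move=> Ii IA; apply: leq_bigmax_cond; rewrite Ii. Qed.

Lemma rk_mono A B : A \subset B -> rk A <= rk B.
Proof.
move=> AB; apply/bigmax_leqP => I /andP[Ii IA].
by apply: leq_rk => //; apply: subset_trans AB.
Qed.

Lemma rk_extend I A : I \in indep M -> I \subset A ->
  exists J, [/\ J \in indep M, I \subset J, J \subset A & #|J| = rk A].
Proof.
move=> Ii IA.
have [K [Ki KA cK]] : exists K, [/\ K \in indep M, K \subset A & #|K| = rk A].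
  have /(@eq_bigmax_cond _ _ (fun I : {set E} => #|I|))[K] :
    0 < #|[pred I : {set E} | (I \in indep M) && (I \subset A)]|.
    by apply/card_gt0P; exists set0; rewrite inE indep0 sub0set.
  by rewrite inE => /andP[Ki KA] e; exists K; split=> //; rewrite -e.
have [n le_n] := ubnP (rk A - #|I|); elim: n I Ii IA le_n => // n IHn I Ii IA.
rewrite ltnS => le_n.
have := leq_rk Ii IA; rewrite leq_eqVlt => /predU1P[e|lt_I].
  by exists I.
have [|x] := indep_aug Ii Ki; first by rewrite cK.
rewrite inE => /andP[xI xK] xIi.
have [||| J [Ji xIJ JA cJ]] := IHn (x |: I) => //.
- by rewrite subUset IA sub1set (subsetP KA).
- by rewrite cardsU1 xI add1n subnS -ltnS prednK ?subn_gt0.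
by exists J; split=> //; apply: subset_trans xIJ; apply: subsetUr.
Qed.

Lemma sub_closure A : A \subset mclosure A.
Proof. by apply/subsetP => x xA; rewrite inE (setUidPr _) ?sub1set. Qed.

Lemma closure_mono A B : A \subset B -> mclosure A \subset mclosure B.
Proof.
move=> AB; apply/subsetP => x; rewrite !inE => /eqP xA.
rewrite eqn_leq (rk_mono (subsetUr _ _)) andbT leqNgt; apply/negP => lt_B.
have [I [Ii _ IA cI]] := rk_extend (indep0 M) (sub0set A).
have [J [Ji IJ JB cJ]] := rk_extend Ii (subset_trans IA AB).
have [K [Ki _ KB cK]] := rk_extend (indep0 M) (sub0set (x |: B)).
have [|y] := indep_aug Ji Ki; first by rewrite cJ cK.
rewrite inE => /andP[yJ /(subsetP KB)]; rewrite !inE => yxB yJi.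
have [yB|yB] := boolP (y \in B).
  have := @leq_rk (y |: J) B yJi; rewrite cardsU1 yJ cJ ltnn subUset sub1set.
  by rewrite yB JB => /(_ isT).
have {yxB} yx : y = x by move: yxB; rewrite (negPf yB) orbF => /eqP.
rewrite {}yx in yJ yJi *.
have xI : x \notin I by apply: contra yJ; apply: (subsetP IJ).
have := @leq_rk (x |: I) (x |: A) (indepS (setUS _ IJ) yJi) (setUS _ IA).
by rewrite xA cardsU1 xI cI ltnn.
Qed.

Lemma rk_closure A : rk (mclosure A) = rk A.
Proof.
apply/eqP; rewrite eqn_leq (rk_mono (sub_closure A)) andbT leqNgt; apply/negP.
have [I [Ii _ IA cI]] := rk_extend (indep0 M) (sub0set A).
have [K [Ki _ KA cK]] := rk_extend (indep0 M) (sub0set (mclosure A)).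
rewrite -cK -cI => lt_I; have [x] := indep_aug Ii Ki lt_I.
rewrite inE => /andP[xI /(subsetP KA)]; rewrite inE => /eqP xA xIi.
by have := leq_rk xIi (setUS _ IA); rewrite xA cardsU1 xI cI ltnn.
Qed.

Lemma closure_flat A : is_flat (mclosure A).
Proof.
rewrite /is_flat eqEsubset sub_closure andbT; apply/subsetP => x.
rewrite !inE rk_closure => /eqP xA.
by rewrite eqn_leq -{1}xA !rk_mono ?subsetUr ?setUS ?sub_closure.
Qed.

Lemma flatI A B : is_flat A -> is_flat B -> is_flat (A :&: B).
Proof.
rewrite /is_flat => /eqP fA /eqP fB.
by rewrite eqEsubset sub_closure subsetI -{2}fA -{3}fB
  !closure_mono ?subsetIl ?subsetIr.
Qed.

Lemma closureT : is_flat setT.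
Proof. by rewrite /is_flat eqEsubset sub_closure subsetT. Qed.

Lemma closure_sub A B : is_flat B -> (mclosure A \subset B) = (A \subset B).
Proof.
move=> /eqP fB; apply/idP/idP => [|AB]; first exact/subset_trans/sub_closure.
by rewrite -fB closure_mono.
Qed.

End Matroid.

Definition matroid_iso (E F : finType) (M : matroid E) (N : matroid F) : Prop :=
  exists2 f : E -> F, bijective f &
    forall I : {set E}, (f @: I \in indep N) = (I \in indep M).

(** * The lattice of flats *)

Record flat (E : finType) (M : matroid E) := Flat {
  flat_set :> {set E};
  flat_setP : is_flat M flat_set
}.

HB.instance Definition _ E (M : matroid E) := [isSub for @flat_set E M].
HB.instance Definition _ E (M : matroid E) := [Finite of flat M by <:].

Fact flat_display : Order.disp_t. Proof. exact: Order.Disp tt tt. Qed.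

Section FlatLattice.
Variables (E : finType) (M : matroid E).
Implicit Types x y z : flat M.

Definition flat_le : rel (flat M) := fun x y => x \subset y.

Fact flat_le_refl : reflexive flat_le.
Proof. by move=> x; apply: subxx. Qed.

Fact flat_le_anti : antisymmetric flat_le.
Proof. by move=> x y xy; apply/val_inj/eqP; rewrite eqEsubset. Qed.

Fact flat_le_trans : transitive flat_le.
Proof. by move=> y x z; apply: subset_trans. Qed.

HB.instance Definition _ := Order.Le_isPOrder.Build flat_display (flat M)
  flat_le_refl flat_le_anti flat_le_trans.

Definition flat_meet x y : flat M := Flat (flatI (flat_setP x) (flat_setP y)).

Definition flat_join x y : flat M := Flat (closure_flat M (x :|: y)).

Definition flat_bot : flat M := Flat (closure_flat M set0).

Definition flat_top : flat M := Flat (closureT M).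

Fact flat_meetP x y z : (x <= flat_meet y z)%O = (x <= y)%O && (x <= z)%O.
Proof. exact: subsetI. Qed.

Fact flat_joinP x y z : (flat_join x y <= z)%O = (x <= z)%O && (y <= z)%O.
Proof.
by rewrite -[LHS]/(mclosure M (x :|: y) \subset z) closure_sub ?subUset ?flat_setP.
Qed.

HB.instance Definition _ := Order.POrder_MeetJoin_isLattice.Build
  flat_display (flat M) flat_meetP flat_joinP.

Fact flat_le0x x : (flat_bot <= x)%O.
Proof. by rewrite -[(_ <= _)%O]/(mclosure M set0 \subset x) closure_sub ?sub0set ?flat_setP. Qed.

Fact flat_lex1 x : (x <= flat_top)%O.
Proof. exact: subsetT. Qed.

HB.instance Definition _ := Order.hasBottom.Build flat_display (flat M) flat_le0x.
HB.instance Definition _ := Order.hasTop.Build flat_display (flat M) flat_lex1.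

Definition flat_rk x : nat := rk M x.

(* For a simple matroid this is the singleton [[set a]], and [flat_atom]
   identifies [E] with the atoms of the lattice. *)
Definition flat_atom (a : E) : flat M := Flat (closure_flat M [set a]).

Lemma le_atom a x : (flat_atom a <= x)%O = (a \in x).
Proof. by rewrite -[LHS]/(mclosure M [set a] \subset x) closure_sub ?sub1set ?flat_setP. Qed.

Lemma join_atoms_le (s : seq E) x :
  (\join_(a <- s) flat_atom a <= x)%O = ([set a in s] \subset x).
Proof.
elim: s => [|a s IHs].
  by rewrite big_nil le0x; apply/esym/subsetP => a; rewrite inE.
by rewrite big_cons leUx IHs le_atom set_cons subUset sub1set.
Qed.

Definition num_ordered_bases x : nat :=
  #|[set t : (flat_rk x).-tuple E | (\join_(a <- t) flat_atom a)%O == x]|.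

Lemma num_ordered_bases_gt0 x : 0 < num_ordered_bases x.
Proof.
have [I [Ii _ Ix cI]] := rk_extend (indep0 M) (sub0set x).
apply/card_gt0P; exists (tcast cI (enum_tuple I)); rewrite inE.
rewrite val_tcast /=.
have eI : [set a in enum I] = I by apply/setP => a; rewrite inE mem_enum.
rewrite eq_le join_atoms_le eI Ix /=; apply/subsetP => a ax.
set y := (\join_(_ <- _) _)%O.
have Iy : I \subset y by rewrite -{1}eI -join_atoms_le.
suff : a \in mclosure M I by apply/subsetP; rewrite closure_sub ?flat_setP.
rewrite inE eqn_leq (rk_mono M (subsetUr _ _)) andbT.
apply: leq_trans (leq_rk Ii (subxx _)); rewrite cI rk_mono //.
by rewrite subUset sub1set ax Ix.
Qed.

End FlatLattice.

Local Open Scope ring_scope.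

(** * Operators on the vector space with basis the flats *)

Section Operators.
Variables (R : realFieldType) (E : finType) (M : matroid E).
Implicit Types (a : E) (x y : flat M) (k : nat).

Definition flat_space := {ffun flat M -> R^o}.
HB.instance Definition _ := GRing.Lmodule.on flat_space.
HB.instance Definition _ := Vector.on flat_space.

Implicit Types u v : flat_space.

Definition flat_vec x : flat_space := [ffun y => (y == x)%:R].

Definition lin_ext (f : flat M -> flat_space) : 'End(flat_space) :=
  linfun (fun u => \sum_x u x *: f x).

Lemma flat_spaceE u : u = \sum_x u x *: flat_vec x.
Proof.
apply/ffunP => y; rewrite sum_ffunE (bigD1 y) //= big1 ?addr0 => [|x /negPf xy].
  by rewrite !ffunE eqxx [_ *: _]mulr1.
by rewrite !ffunE eq_sym xy [_ *: _]mulr0.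
Qed.

Lemma lin_extE f u : lin_ext f u = \sum_x u x *: f x.
Proof.
pose g u : flat_space := \sum_x u x *: f x.
have g_lin : linear g.
  move=> c v w; rewrite /g scaler_sumr -big_split /=; apply: eq_bigr => x _.
  by rewrite !ffunE scalerDl scalerA.
pose gL := GRing.isLinear.Build _ _ _ _ g g_lin.
pose G : {linear flat_space -> flat_space} := HB.pack g gL.
exact: (lfunE G).
Qed.

Lemma lin_ext_vec f x : lin_ext f (flat_vec x) = f x.
Proof.
rewrite lin_extE (bigD1 x) //= big1 ?addr0 => [|y /negPf yx].
  by rewrite ffunE eqxx scale1r.
by rewrite ffunE yx scale0r.
Qed.

Definition beta x : R := (num_ordered_bases x)%:R.

Definition inner_beta u v : R := \sum_x u x * v x / beta x.

(* The adjoint of [f] for [inner_beta], through its coordinates in the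
   orthogonal basis [flat_vec]; see [adjoint_betaP] and [adjoint_beta_uniq] *)
Definition adjoint_beta (f : 'End(flat_space)) : 'End(flat_space) :=
  lin_ext (fun y =>
    \sum_x (beta x * inner_beta (flat_vec y) (f (flat_vec x))) *: flat_vec x).

Lemma inner_beta_vecr u x : inner_beta u (flat_vec x) = u x / beta x.
Proof.
rewrite /inner_beta (bigD1 x) //= big1 ?addr0 => [|y /negPf yx].
  by rewrite ffunE eqxx mulr1.
by rewrite ffunE yx mulr0 mul0r.
Qed.

Lemma inner_beta_suml (I : finType) (c : I -> R) (w : I -> flat_space) v :
  inner_beta (\sum_i c i *: w i) v = \sum_i c i * inner_beta (w i) v.
Proof.
rewrite /inner_beta; under [RHS]eq_bigr do rewrite mulr_sumr.
rewrite exchange_big /=; apply: eq_bigr => x _.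
rewrite sum_ffunE !mulr_suml; apply: eq_bigr => i _.
by rewrite !ffunE !mulrA.
Qed.

Lemma inner_betaC u v : inner_beta u v = inner_beta v u.
Proof. by apply: eq_bigr => x _; rewrite (mulrC (u x)). Qed.

Lemma beta_neq0 x : beta x != 0.
Proof. by rewrite pnatr_eq0 -lt0n num_ordered_bases_gt0. Qed.

Lemma adjoint_betaP f u v :
  inner_beta (adjoint_beta f u) v = inner_beta u (f v).
Proof.
rewrite [in RHS](flat_spaceE u) [in RHS](flat_spaceE v) linear_sum /=.
rewrite lin_extE !inner_beta_suml; apply: eq_bigr => y _; congr (_ * _).
rewrite inner_beta_suml [RHS]inner_betaC.
under [in RHS]eq_bigr do rewrite linearZ /=.
rewrite inner_beta_suml; apply: eq_bigr => x _.
rewrite [inner_beta _ v]inner_betaC inner_beta_vecr.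
rewrite [inner_beta (f _) _]inner_betaC.
by rewrite mulrC mulrA divfK // beta_neq0.
Qed.

Lemma adjoint_beta_uniq (f g : 'End(flat_space)) :
  (forall u v, inner_beta (g u) v = inner_beta u (f v)) -> g = adjoint_beta f.
Proof.
move=> gP; apply/lfunP => u; apply/ffunP => x.
have := gP u (flat_vec x); rewrite -adjoint_betaP !inner_beta_vecr.
by move/(mulIf (invr_neq0 (beta_neq0 x))).
Qed.

Definition join_op a : 'End(flat_space) :=
  lin_ext (fun x =>
    if (flat_atom M a <= x)%O then 0 else flat_vec (x `|` flat_atom M a)%O).

Definition join_op_beta a : 'End(flat_space) := adjoint_beta (join_op a).

Definition U_beta : 'End(flat_space) := \sum_a join_op_beta a.

Definition K_op : 'End(flat_space) :=
  lin_ext (fun x => (flat_rk x)%:R *: flat_vec x).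

Definition num_atoms_not_below x : nat :=
  (#|E| - #|[set a | (flat_atom M a <= x)%O]|)%N.

Definition Sinv_op : 'End(flat_space) :=
  lin_ext (fun x =>
    if (x < \top)%O then (num_atoms_not_below x)%:R^-1 *: flat_vec x else 0).

Definition D_beta : 'End(flat_space) := (Sinv_op \o U_beta \o K_op)%VF.

Definition layer_vec k : flat_space :=
  \sum_(x : flat M | flat_rk x == k) beta x *: flat_vec x.

Definition top_vec : flat_space := layer_vec (matroid_rank M).

Fixpoint C_beta k : {vspace flat_space} :=
  if k is k'.+1 then
    (D_beta @: C_beta k' + \sum_a (join_op_beta a @: C_beta k'))%VS
  else <[top_vec]>%VS.

Definition h_beta k : nat := \dim (C_beta k).

Definition H_beta : {poly int} :=
  \sum_(k < (matroid_rank M).+1) (h_beta k)%:Z *: 'X^k.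

Definition C_zero k : {vspace flat_space} :=
  <<[seq foldl (fun u a => join_op_beta a u) top_vec t | t : k.-tuple E]>>%VS.

Definition h_zero k : nat := \dim (C_zero k).

Definition H_zero : {poly int} :=
  \sum_(k < (matroid_rank M).+1) (h_zero k)%:Z *: 'X^k.

End Operators.

(* Main.v *)
From HB Require Import structures.
From Stdlib Require Import NArith ZArith.
Require Import Defs.
From mathcomp Require Import all_boot all_order all_algebra reals zify ssrZ.

Set Implicit Arguments.
Unset Strict Implicit.
Unset Printing Implicit Defensive.

Import Order.TTheory GRing.Theory Num.Theory.

(** Both the classification and the dimension counts are reduced to finite
computations whose results carry certificates, so that only the certificates
have to be checked.

_The matroids._  Along a listing of its ground set, a rank function is a
decision tree.  An extension of a matroid by one element [e] is determined by
the set function telling which sets [e] raises the rank of; submodularity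
makes the trees of such functions enumerable by recursion ([extensions],
[extensions_complete]).  Starting from the empty ground set, all simple
matroids on [n.+1] elements arise from those on [n] elements.  It is enough to
adjoin an element that is as free as possible, because every matroid is an
extension of the deletion of its freest element; this discards most of the
extensions.  Each of the remaining ones is matched by an explicit permutation
with an entry of the list for [n.+1] elements ([step_complete]), whence the
list of 950 trees is complete by induction.  No two of them are isomorphic,
since they are separated by a numerical invariant of the rank function: the sum
over all subsets of a hash of the rank and of a Fourier coefficient of the rank
modulo 3 ([rank_invariant_iso]).

_The operators._  In the coordinates divided by [beta], the operator
[join_op_beta R M a] is the substitution of [a |: X] for [X] where [a] raises
the rank and zero elsewhere, and [D_beta] is, up to a nonzero factor on each
layer, the average of these substitutions over the raising elements
([join_op_vec], [D_vec]); the numbers of ordered bases have disappeared.  Hence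
[C_beta R M k] is spanned by the words of length [k] in the substitutions and
the average, and [C_zero R M k] by those without the average.  The averages are
over at most 8 elements, so a word with [j] averages has integral values once
multiplied by [840 ^ j], 840 being the least common multiple of 1, ..., 8.

_Lower bounds_ on [h_beta R M k] are lists of words which Gaussian elimination
over the integers shows independent on suitable flats ([independent_dim]).

_Upper bounds._  The vectors of [C_beta R M k] are supported on the flats of
rank [r - k], so there is the number of these flats, which is lowered by the
number of independent functionals killing all words ([dim_layer_leq]); and
[h_beta R M 1] is at most 9, the number of words of length one.  These bounds
turn out to be good enough for the strict inequalities.

_Comparison with the commuting part._  For 894 of the matroids a functional
kills all words of some length without average but not some word beginning with
an average, so that [h_zero R M k < h_beta R M k] for that length [k]
([averages_escapeP]).  For the other 56, explicit relations express the average
of any word without average through such words, whence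
[C_beta R M k = C_zero R M k] for all [k] ([averages_commuteP]).  In the latter
case the dimensions are even symmetric, because [h_zero R M k] is the rank of
the incidence matrix of the complementary pairs of flats of ranks [k] and
[r - k], which is transposed when [k] is replaced by [r - k] ([h_zero_sym]). *)

(** * Decision trees on subsets *)

(** Unlike [&&], a notation that leaves its second argument unevaluated under
every strategy when the first one is false. *)
Notation "a <&&> b" := (if a then b else false)
  (at level 40, left associativity).

(** A function on the subsets of a listed set: a node decides whether its first
element belongs to the subset.  A leaf is a constant function, whatever
elements remain, so that equal subtrees of rank functions collapse. *)
Inductive tree (T : Type) := Leaf of T | Node of tree T & tree T.

Fixpoint tree_eq (T : eqType) (t u : tree T) : bool :=
  match t, u with
  | Leaf x, Leaf y => x == y
  | Node a b, Node c d => tree_eq a c && tree_eq b d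
  | _, _ => false
  end.

Lemma tree_eqP (T : eqType) : Equality.axiom (@tree_eq T).
Proof.
elim=> [x|a IHa b IHb] [y|c d] /=; try by constructor.
  by apply: (iffP eqP) => [->|[]].
by apply: (iffP andP) => [[/IHa-> /IHb->]|[<- <-]] //; split; [apply/IHa|apply/IHb].
Qed.

HB.instance Definition _ (T : eqType) := hasDecEq.Build (tree T) (@tree_eqP T).

Section Trees.
Variables A B C : Type.
Implicit Types (t a b : tree A) (m : seq bool) (n i : nat).

Definition lo t := if t is Node a _ then a else t.
Definition hi t := if t is Node _ b then b else t.

Fixpoint look t m : A :=
  match t, m with
  | Leaf x, _ => x
  | Node a b, c :: m' => look (if c then b else a) m'
  | Node a _, [::] => look a [::]
  end.

(** The depth is at most [n]: the tree decides no element beyond the first [n]. *)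
Fixpoint fits n t {struct t} : bool :=
  if t is Node a b then
    if n is n'.+1 then fits n' a && fits n' b else false
  else true.

Lemma fitsS n t : fits n.+1 t = fits n (lo t) && fits n (hi t).
Proof. by case: t => [x|a b] //=; case: n. Qed.

Lemma look_cons t c m : look t (c :: m) = look (if c then hi t else lo t) m.
Proof. by case: t => [x|a b] //; case: c. Qed.

Lemma look_nil t : look t [::] = look (lo t) [::].
Proof. by case: t. Qed.

End Trees.

Fixpoint tmap A B (f : A -> B) (t : tree A) : tree B :=
  match t with
  | Leaf x => Leaf (f x)
  | Node a b => Node (tmap f a) (tmap f b)
  end.

Fixpoint map2 A B C (f : A -> B -> C) (a : tree A) (b : tree B) : tree C :=
  match a with
  | Leaf x => tmap (f x) b
  | Node a0 a1 => Node (map2 f a0 (lo b)) (map2 f a1 (hi b))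
  end.

Lemma look_tmap A B (f : A -> B) t m : look (tmap f t) m = f (look t m).
Proof. by elim: t m => [x|a IHa b IHb] [|[] m] //=. Qed.

Lemma look_map2 A B C (f : A -> B -> C) a b m :
  look (map2 f a b) m = f (look a m) (look b m).
Proof.
elim: a b m => [x|a0 IH0 a1 IH1] b m; first by rewrite /= look_tmap; case: m.
by case: m => [|[] m] /=; rewrite ?(look_cons b) ?(look_nil b) ?IH0 ?IH1.
Qed.

Lemma fits_tmap A B (f : A -> B) n t : fits n (tmap f t) = fits n t.
Proof. by elim: t n => [x|a IHa b IHb] [|n] //=; rewrite IHa IHb. Qed.

Lemma fits_map2 A B C (f : A -> B -> C) n a b :
  fits n a -> fits n b -> fits n (map2 f a b).
Proof.
elim: a b n => [x|a0 IH0 a1 IH1] b n; first by rewrite /= fits_tmap.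
case: n => [//|n]; rewrite (fitsS _ b) /= => /andP[f0 f1] /andP[fl fh].
by rewrite IH0 ?IH1.
Qed.

Fixpoint all_leaves (t : tree bool) : bool :=
  match t with Leaf x => x | Node a b => all_leaves a <&&> all_leaves b end.

Lemma all_leavesE t m : all_leaves t -> look t m.
Proof. by elim: t m => [x|a IHa b IHb] [|[] m] //= /andP[? ?]; auto. Qed.

Lemma all_leavesI n (t : tree bool) :
  fits n t -> (forall m, size m = n -> look t m) -> all_leaves t.
Proof.
elim: t n => [x|a IHa b IHb] [|n] //=.
- by move=> _ /(_ [::]); apply.
- by move=> _ /(_ (nseq n.+1 true)); apply; rewrite size_nseq.
case/andP=> fa fb all_t; apply/andP; split.
  by apply: (IHa n) => // m sm; apply: (all_t (false :: m)); rewrite /= sm.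
by apply: (IHb n) => // m sm; apply: (all_t (true :: m)); rewrite /= sm.
Qed.

Definition le_tree (a b : tree bool) : bool := all_leaves (map2 implb a b).

Fixpoint setb (m : seq bool) (i : nat) : seq bool :=
  match m, i with
  | [::], _ => [::]
  | _ :: m', 0 => true :: m'
  | b :: m', i'.+1 => b :: setb m' i'
  end.

Lemma size_setb m i : size (setb m i) = size m.
Proof. by elim: m i => [|b m IH] [|i] //=; rewrite IH. Qed.

(** The family of subsets described by [e] is closed under taking subsets. *)
Fixpoint decr (e : tree bool) : bool :=
  match e with
  | Leaf _ => true
  | Node a b => le_tree b a <&&> decr a <&&> decr b
  end.

Lemma decrE e m i : decr e -> look e (setb m i) -> look e m.
Proof.
elim: e m i => [//|a IHa b IHb] [|c m] [|i] //= /andP[/andP[ba da] db].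
  case: c => // bm; have := all_leavesE m ba.
  by rewrite look_map2 bm.
by case: c; [apply: IHb | apply: IHa].
Qed.

Lemma decrI n (e : tree bool) : fits n e ->
  (forall m i, size m = n -> i < n -> look e (setb m i) -> look e m) -> decr e.
Proof.
elim: e n => [//|a IHa b IHb] [//|n] /= /andP[fa fb] e_decr.
apply/andP; split; first (apply/andP; split).
- apply: (@all_leavesI n); first exact: fits_map2.
  move=> m sm; rewrite look_map2; apply/implyP => bm.
  by apply: (e_decr (false :: m) 0) => //=; rewrite sm.
- apply: (IHa n) => // m i sm lt_i am.
  by apply: (e_decr (false :: m) i.+1) => //=; rewrite sm.
apply: (IHb n) => // m i sm lt_i bm.
by apply: (e_decr (true :: m) i.+1) => //=; rewrite sm.
Qed.

(** * Reading a tree along a listing of the ground set *)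

Section Listing.
Variable E : finType.
Implicit Types (s : seq E) (A X : {set E}) (x : E).

Definition ind s A : seq bool := [seq x \in A | x <- s].

Definition ev T s (t : tree T) A : T := look t (ind s A).

Definition setof s (m : seq bool) : {set E} := [set x in mask m s].

Lemma size_ind s A : size (ind s A) = size s.
Proof. exact: size_map. Qed.

Lemma ev_cons T x s (t : tree T) A :
  ev (x :: s) t A = if x \in A then ev s (hi t) A else ev s (lo t) A.
Proof. by rewrite /ev /= look_cons; case: ifP. Qed.

Lemma ev_map2 T U V (f : T -> U -> V) s a b A :
  ev s (map2 f a b) A = f (ev s a A) (ev s b A).
Proof. exact: look_map2. Qed.

Lemma ind_setU1 x s A : x \notin s -> ind s (x |: A) = ind s A.
Proof.
by move=> xs; apply/eq_in_map => y ys; rewrite !inE; case: eqP xs ys => // -> /negPf->.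
Qed.

Lemma ev_setU1 T x s (t : tree T) A : x \notin s -> ev s t (x |: A) = ev s t A.
Proof. by move=> xs; rewrite /ev ind_setU1. Qed.

Lemma setofK s m : uniq s -> size m = size s -> ind s (setof s m) = m.
Proof.
elim: s m => [|x s IH] [|c m] //= /andP[xs us] [sm].
have -> : ind s (setof (x :: s) (c :: m)) = ind s (setof s m).
  apply/eq_in_map => y ys; rewrite !inE; case: c => //=; rewrite inE.
  by case: eqP xs ys => // -> /negPf->.
rewrite IH //; congr (_ :: _); rewrite !inE; case: c => /=; first by rewrite inE eqxx.
by apply/negbTE; apply: contra xs; apply: mem_mask.
Qed.

Lemma indK s A : A \subset s -> setof s (ind s A) = A.
Proof.
move=> /subsetP As; apply/setP => x; rewrite inE /ind -filter_mask mem_filter.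
by case: (boolP (x \in A)) => // /As.
Qed.

Lemma setof_sub s m : setof s m \subset s.
Proof. by apply/subsetP => x; rewrite inE; apply: mem_mask. Qed.

Lemma look_setof T s (t : tree T) m : uniq s -> size m = size s ->
  look t m = ev s t (setof s m).
Proof. by move=> us sm; rewrite /ev setofK. Qed.

Lemma ind_set_nth x0 s A i : uniq s -> i < size s ->
  ind s (nth x0 s i |: A) = setb (ind s A) i.
Proof.
elim: s i => [//|x s IH] [|i] /= /andP[xs us] lt_i.
  by rewrite ind_setU1 // !inE eqxx.
rewrite IH // !inE; case: eqP => // e.
by rewrite e mem_nth in xs.
Qed.

Lemma setof_setb x0 s m i : uniq s -> size m = size s -> i < size s ->
  setof s (setb m i) = nth x0 s i |: setof s m.
Proof.
move=> us sm lt_i; rewrite -[in setb _ _](setofK us sm) -(ind_set_nth x0) // indK //.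
by apply/subsetP => x; rewrite !inE => /orP[/eqP->|/mem_mask //]; rewrite mem_nth.
Qed.

Lemma all_leaves_ev s (t : tree bool) : uniq s -> fits (size s) t ->
  (forall A, A \subset s -> ev s t A) -> all_leaves t.
Proof.
move=> us ft all_t; apply: (all_leavesI ft) => m sm.
by rewrite (look_setof t us sm) all_t ?setof_sub.
Qed.

Lemma decr_ev s (e : tree bool) : uniq s -> fits (size s) e ->
  (forall A x, A \subset s -> x \in s -> ev s e (x |: A) -> ev s e A) -> decr e.
Proof.
case: s => [|x0 s0]; first by case: e.
set s := x0 :: s0; move=> us fe e_decr; apply: (decrI fe) => m i sm lt_i.
rewrite !(@look_setof _ s) ?size_setb // (@setof_setb x0) //.
by apply: e_decr; rewrite ?setof_sub ?mem_nth.
Qed.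

Lemma ev_decr s (e : tree bool) A x : uniq s -> decr e -> x \in s ->
  ev s e (x |: A) -> ev s e A.
Proof.
move=> us de xs; rewrite /ev -{1}(nth_index x xs) ind_set_nth ?index_mem //.
exact: decrE.
Qed.

(** The recursion on which all evaluations of trees by summation rest. *)
Lemma big_subset_cons (T : Type) (idx : T) (op : Monoid.com_law idx)
    x s (F : {set E} -> T) : x \notin s ->
  \big[op/idx]_(A : {set E} | A \subset x :: s) F A =
  op (\big[op/idx]_(A : {set E} | A \subset s) F A)
     (\big[op/idx]_(A : {set E} | A \subset s) F (x |: A)).
Proof.
move=> xs; rewrite (bigID (fun A => x \in A)) /= Monoid.mulmC; congr (op _ _).
  apply: eq_bigl => A; apply/andP/subsetP => [[/subsetP As xA] y yA|As].
    by have := As y yA; rewrite inE; case: eqP xA => // <-; rewrite yA.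
  split; first by apply/subsetP => y /As ys; rewrite inE ys orbT.
  by apply: contra xs; apply: As.
rewrite (reindex_onto (fun A => x |: A) (fun A => A :\ x)) /=; last first.
  by move=> A /andP[_ xA]; rewrite setD1K.
apply: eq_bigl => A; rewrite setU11 andbT; apply/andP/subsetP => [[/subsetP As]|As].
  move=> /eqP eA y yA; have := As y; rewrite !inE yA orbT => /(_ isT).
  by case: eqP => // yx; move: yA; rewrite -eA yx !inE eqxx.
have xA : x \notin A by apply: contra xs; apply: As.
split; last by rewrite setU1K.
by apply/subsetP => y; rewrite !inE => /orP[->//|/As->]; rewrite orbT.
Qed.

Lemma big_subset_nil (T : Type) (idx : T) (op : Monoid.com_law idx)
    (F : {set E} -> T) :
  \big[op/idx]_(A : {set E} | A \subset [::]) F A = F set0.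
Proof.
rewrite (big_pred1 set0) // => A /=; rewrite -subset0.
by apply: eq_subset_r => x; rewrite !inE.
Qed.

End Listing.

(** * Rank functions *)

Section MatroidRank.
Variables (E : finType) (M : matroid E).
Implicit Types (x y : E) (A B I : {set E}).

Lemma rk_leq_card A : rk M A <= #|A|.
Proof. by apply/bigmax_leqP => I /andP[_ IA]; apply: subset_leq_card. Qed.

Lemma rk_indep I : (I \in indep M) = (rk M I == #|I|).
Proof.
apply/idP/eqP => [Ii|rI].
  by apply/eqP; rewrite eqn_leq rk_leq_card leq_rk.
have [J [Ji _ JI cJ]] := rk_extend (indep0 M) (sub0set I).
by rewrite -(_ : J = I) //; apply/eqP; rewrite eqEcard JI cJ rI /=.
Qed.

Lemma rk_setU1_gt x A : (rk M A < rk M (x |: A)) = (rk M (x |: A) != rk M A).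
Proof. by rewrite ltn_neqAle rk_mono ?subsetUr // andbT eq_sym. Qed.

Lemma rk_setU1_leq x A : rk M (x |: A) <= (rk M A).+1.
Proof.
have [J [Ji _ JA cJ]] := rk_extend (indep0 M) (sub0set (x |: A)).
rewrite -cJ (cardsD1 x J) -[_.+1]add1n leq_add ?leq_b1 //.
apply: leq_rk; first by apply: indepS Ji; apply: subD1set.
by rewrite subDset.
Qed.

Lemma rk_setU1 x A : rk M (x |: A) = rk M A + (rk M A < rk M (x |: A)).
Proof.
have := rk_setU1_leq x A; have: rk M A <= rk M (x |: A) by rewrite rk_mono ?subsetUr.
lia.
Qed.

(** Submodularity in the form in which it is used throughout: the elements
that raise the rank of a set raise the rank of all its subsets. *)
Lemma rk_grow_sub x A B : A \subset B ->
  rk M B < rk M (x |: B) -> rk M A < rk M (x |: A).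
Proof.
rewrite !rk_setU1_gt => AB; apply: contra => xA.
by have /subsetP := closure_mono M AB; move/(_ x); rewrite !inE; apply.
Qed.

Lemma simple_rk1 x : simple_matroid M -> rk M [set x] = 1.
Proof. by case/andP=> /forallP/(_ x); rewrite rk_indep cards1 => /eqP. Qed.

Lemma simple_rk2 x y : simple_matroid M -> x != y -> rk M [set x; y] = 2.
Proof.
case/andP=> _ /forallP/(_ x)/forallP/(_ y)/implyP H ne; move: (H ne).
by rewrite rk_indep cards2 ne => /eqP.
Qed.

End MatroidRank.

(** * Single-element extensions *)

Definition node (T : eqType) (a b : tree T) : tree T :=
  match a, b with
  | Leaf x, Leaf y => if x == y then a else Node a b
  | _, _ => Node a b
  end.

Definition growth : tree nat -> tree nat -> tree bool := map2 Nat.ltb.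

(** Let [a] and [b] be the ranks of the sets without and with an element [x],
[g] the sets that [x] raises, and [c], [d] the sets without and with [x] that a
new element [e] raises.  Submodularity gives [d <= c].  Where [x] raises
nothing, [A] and [x |: A] have the same closure, so that [c = d].  Finally
[g] and [eqb c d] together describe the sets that [x] raises after contraction
of [e], a family closed under subsets. *)
Definition compatible (g c d : tree bool) : bool :=
  le_tree d c <&&> all_leaves (map2 orb g (map2 eqb c d))
    <&&> decr (map2 andb g (map2 eqb c d)).

Definition merge (g : tree bool) (cs ds : seq (tree bool)) : seq (tree bool) :=
  flatten [seq [seq node c d | d <- ds & compatible g c d] | c <- cs].

(** [k] counts the elements already in the set.  On a leaf, no remaining
element changes the rank, so [e] raises all sets or none; in a simple matroid it
raises the sets with fewer than two elements. *)
Fixpoint extensions (k : nat) (t : tree nat) : seq (tree bool) :=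
  match t with
  | Leaf _ => if k is _.+2 then [:: Leaf false; Leaf true] else [:: Leaf true]
  | Node a b => merge (growth a b) (extensions k a) (extensions k.+1 b)
  end.

Fixpoint weight (n : nat) (t : tree bool) : nat :=
  match t with
  | Leaf b => if b then iter n (fun x => x + x) 1 else 0
  | Node a b => weight n.-1 a + weight n.-1 b
  end.

(** The filter keeps the extensions whose new element raises at least as many
sets as the first element of the listing; the sets compared contain neither of
the two. *)
Definition free_extensions (n : nat) (t : tree nat) : seq (tree bool) :=
  match t with
  | Leaf _ => extensions 0 t
  | Node a b =>
    let w := weight n.-1 (growth a b) in
    merge (growth a b)
      [seq c <- extensions 0 a | Nat.leb w (weight n.-1 c)] (extensions 1 b)
  end.

Definition extend (t : tree nat) (d : tree bool) : tree nat :=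
  Node t (map2 (fun (x : nat) (g : bool) => if g then x.+1 else x) t d).

Lemma ltbE m n : Nat.ltb m n = (m < n).
Proof. lia. Qed.

Lemma lebE m n : Nat.leb m n = (m <= n).
Proof. lia. Qed.

Lemma fits_node (T : eqType) n (a b : tree T) :
  fits n a -> fits n b -> fits n.+1 (node a b).
Proof.
case: a b => [x|a0 a1] [y|b0 b1] //=.
  by case: (x == y).
  by move=> fa _; rewrite fa.
by move=> -> ->.
Qed.

(** Counting the rank of a set with both elements in two ways determines
whether [x] raises a set that already contains [e]. *)
Lemma growth_swap (g1 g2 g3 g4 : bool) m :
  (g3 -> g2) -> m + g1 + g3 = m + g2 + g4 -> g1 && eqb g2 g3 = g4.
Proof.
by rewrite -!addnA => g23 /addnI; case: g1 g2 g3 g4 g23 => [] [] [] [] // /(_ isT).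
Qed.

Section Extensions.
Variable E : finType.
Implicit Types (s : seq E) (A B : {set E}) (x e : E).

Lemma ev_node (T : eqType) x s (a b : tree T) A :
  ev (x :: s) (node a b) A = if x \in A then ev s b A else ev s a A.
Proof.
suff -> : ev (x :: s) (node a b) A = ev (x :: s) (Node a b) A by rewrite ev_cons.
case: a b => [u|a0 a1] [v|b0 b1] //=; case: eqP => // ->.
by rewrite !ev_cons /= !if_same.
Qed.

Lemma weightE s (t : tree bool) : uniq s -> fits (size s) t ->
  weight (size s) t = \sum_(A : {set E} | A \subset s) ev s t A.
Proof.
elim: s t => [|x s IH] t.
  by move=> _; rewrite big_subset_nil; case: t => [[]|].
move=> /andP[xs us]; rewrite fitsS big_subset_cons //= => /andP[fl fh].
have -> : weight (size s).+1 t = weight (size s) (lo t) + weight (size s) (hi t).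
  by case: t {fl fh} => [[]|].
rewrite !IH //; congr (_ + _); apply: eq_bigr => A As; rewrite ev_cons.
  by case: ifP => // xA; rewrite (subsetP As) in xs.
by rewrite setU11 ev_setU1.
Qed.

Variable M : matroid E.
Hypothesis simpleM : simple_matroid M.

Lemma merge_complete (cs ds : seq (tree bool)) e x s a b B c d :
  uniq (x :: s) -> fits (size s) a -> fits (size s) b ->
  (forall A, A \subset s -> ev s a A = rk M (B :|: A)) ->
  (forall A, A \subset s -> ev s b A = rk M (x |: B :|: A)) ->
  c \in cs -> fits (size s) c ->
  (forall A, A \subset s ->
     ev s c A = (rk M (B :|: A) < rk M (e |: (B :|: A)))) ->
  d \in ds -> fits (size s) d ->
  (forall A, A \subset s ->
     ev s d A = (rk M (x |: B :|: A) < rk M (e |: (x |: B :|: A)))) ->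
  exists d', [/\ d' \in merge (growth a b) cs ds, fits (size s).+1 d' &
    forall A, A \subset x :: s ->
      ev (x :: s) d' A = (rk M (B :|: A) < rk M (e |: (B :|: A)))].
Proof.
move=> /andP[xs us] fa fb aE bE c_in fc cE d_in fd dE.
have fg : fits (size s) (growth a b) by apply: fits_map2.
have feq : fits (size s) (map2 eqb c d) by apply: fits_map2.
have gE A : A \subset s ->
    ev s (growth a b) A = (rk M (B :|: A) < rk M (x |: (B :|: A))).
  by move=> As; rewrite ev_map2 aE ?bE // ltbE setUA.
exists (node c d); split.
- apply/flatten_mapP; exists c => //; apply/mapP; exists d => //.
  rewrite mem_filter d_in andbT; apply/andP; split; first (apply/andP; split).
  + apply: all_leaves_ev (us) (fits_map2 _ fd fc) _ => A As.
    rewrite ev_map2 cE // dE // -setUA; apply/implyP; apply: rk_grow_sub.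
    exact: subsetUr.
  + apply: all_leaves_ev (us) (fits_map2 _ fg feq) _ => A As.
    rewrite 2!ev_map2 gE // cE // dE // -setUA.
    case: ltnP => //= le_x; apply/eqP.
    have eq_x : rk M (x |: (B :|: A)) = rk M (B :|: A).
      by apply/eqP; rewrite eqn_leq le_x rk_mono ?subsetUr.
    rewrite eq_x [e |: (x |: _)]setUCA; congr (_ < _); apply/esym/eqP.
    rewrite -[_ == _]negbK -rk_setU1_gt; apply/negP => /rk_grow_sub.
    by move=> /(_ _ (subsetUr [set e] _)); rewrite eq_x ltnn.
  apply: decr_ev (us) (fits_map2 _ fg feq) _ => A y As ys.
  have yAs : y |: A \subset s.
    by apply/subsetP => z; rewrite !inE => /orP[/eqP->|/(subsetP As)].
  (* on the contraction by [e], the element [x] still grows decreasingly *)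
  have key A' : A' \subset s -> ev s (map2 andb (growth a b) (map2 eqb c d)) A' =
      (rk M (e |: (B :|: A')) < rk M (x |: (e |: (B :|: A')))).
    move=> A's; rewrite 2!ev_map2 gE // cE // dE // -setUA.
    apply: (@growth_swap _ _ _ _ (rk M (B :|: A'))).
      exact/rk_grow_sub/subsetUr.
    by rewrite -!rk_setU1 setUCA.
  rewrite !key //; apply: rk_grow_sub; rewrite setUS // setUS //; exact: subsetUr.
- exact: fits_node.
move=> A Axs; rewrite ev_node; case: ifPn => xA; last first.
  rewrite cE //; apply/subsetP => y yA; have := subsetP Axs y yA.
  by rewrite inE => /orP[/eqP yx|//]; rewrite -yx yA in xA.
have As : A :\ x \subset s.
  apply/subsetP => y; rewrite !inE => /andP[yx /(subsetP Axs)].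
  by rewrite inE (negPf yx).
have -> : ev s d A = ev s d (A :\ x) by rewrite -(ev_setU1 d (A :\ x) xs) setD1K.
by rewrite dE // -[x |: B :|: _]setUA -(setUCA B) setD1K.
Qed.

Lemma extensions_complete e s t B k :
  uniq s -> fits (size s) t -> {in s, forall x, x \notin B} -> #|B| = k ->
  e \notin B -> e \notin s ->
  (forall A, A \subset s -> ev s t A = rk M (B :|: A)) ->
  exists d, [/\ d \in extensions k t, fits (size s) d & forall A, A \subset s ->
    ev s d A = (rk M (B :|: A) < rk M (e |: (B :|: A)))].
Proof.
elim: t s B k => [n|a IHa b IHb] s B k us ft sB cB eB es tE.
  have grow A : A \subset s ->
      (rk M (B :|: A) < rk M (e |: (B :|: A))) = (rk M B < rk M (e |: B)).
    move=> As; have : rk M (B :|: A) = rk M B.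
      rewrite -[in RHS](setU0 B) -!tE //; apply/subsetP => y; by rewrite inE.
    move=> eqA; apply/idP/idP; first exact/rk_grow_sub/subsetUl.
    by rewrite eqA => /leq_trans; apply; rewrite rk_mono ?setUS ?subsetUl.
  exists (Leaf (rk M B < rk M (e |: B))); split=> //; last by move=> A /grow->.
  case: k cB => [|[|k]] cB /=; rewrite inE.
  - have B0 : B = set0 by apply/eqP; rewrite -cards_eq0 cB.
    rewrite B0 setU0 simple_rk1 //.
    by have := rk_leq_card M set0; rewrite cards0 leqn0 => /eqP->.
  - have /cards1P[x Bx] : #|B| == 1 by rewrite cB.
    rewrite Bx simple_rk1 // simple_rk2 //.
    by apply: contraNneq eB => ->; rewrite Bx set11.
  by case: (_ < _).
case: s us ft sB es tE => [//|x s] /= /andP[xs us] /andP[fa fb] sB.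
rewrite inE => /norP[ex es] tE.
have xB : x \notin B by apply: sB; rewrite mem_head.
have sub_cons A : A \subset s -> A \subset x :: s.
  by move=> As; apply/subsetP => y /(subsetP As) ys; rewrite inE ys orbT.
have aE A : A \subset s -> ev s a A = rk M (B :|: A).
  move=> As; rewrite -tE ?sub_cons // ev_cons /=.
  by case: ifP => // /(subsetP As); rewrite (negPf xs).
have bE A : A \subset s -> ev s b A = rk M (x |: B :|: A).
  move=> As; rewrite -setUA setUCA -tE ?ev_cons ?setU11 ?ev_setU1 //.
  by apply/subsetP => y; rewrite !inE => /orP[->//|/(subsetP As)->]; rewrite orbT.
have [c [c_in fc cE]] : exists c, [/\ c \in extensions k a, fits (size s) c &
    forall A, A \subset s -> ev s c A = (rk M (B :|: A) < rk M (e |: (B :|: A)))].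
  by apply: IHa => // y ys; apply: sB; rewrite inE ys orbT.
have [d [d_in fd dE]] : exists d, [/\ d \in extensions k.+1 b, fits (size s) d &
    forall A, A \subset s ->
      ev s d A = (rk M (x |: B :|: A) < rk M (e |: (x |: B :|: A)))].
  apply: IHb => //.
  - move=> y ys; rewrite !inE negb_or sB ?inE ?ys ?orbT // andbT.
    by apply: contraNneq xs => <-.
  - by rewrite cardsU1 xB cB.
  by rewrite !inE negb_or ex.
by apply: merge_complete c_in fc cE d_in fd dE => //=; rewrite xs.
Qed.

End Extensions.

(** * Relabelling *)

(** [pull0 i] and [pull1 i] restrict to the subsets without and with the element
of index [i]. *)
Fixpoint pull0 T i (t : tree T) {struct t} : tree T :=
  match t with
  | Leaf _ => t
  | Node a b => if i is j.+1 then Node (pull0 j a) (pull0 j b) else a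
  end.

Fixpoint pull1 T i (t : tree T) {struct t} : tree T :=
  match t with
  | Leaf _ => t
  | Node a b => if i is j.+1 then Node (pull1 j a) (pull1 j b) else b
  end.

Definition same_tree (t u : tree nat) : bool := all_leaves (map2 eqn t u).

(** The entries of [sg] are successive: each is an index into the elements that
the preceding ones have left. *)
Fixpoint relabels n (sg : seq nat) (t u : tree nat) : bool :=
  match n, sg with
  | n'.+1, i :: sg' => Nat.ltb i n <&&> relabels n' sg' (pull0 i t) (lo u)
                       <&&> relabels n' sg' (pull1 i t) (hi u)
  | _, _ => same_tree t u
  end.

Section Relabelling.
Variable E : finType.
Implicit Types (s : seq E) (A : {set E}).

Definition del i s := take i s ++ drop i.+1 s.

Fixpoint relabel sg s : seq E :=
  match sg, s with
  | i :: sg', x0 :: _ => nth x0 s i :: relabel sg' (del i s)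
  | _, _ => s
  end.

Lemma perm_del x0 s i : i < size s -> perm_eq (nth x0 s i :: del i s) s.
Proof.
move=> lt_i; rewrite -[X in perm_eq _ X](cat_take_drop i s) (drop_nth x0) //.
rewrite perm_sym -[_ :: drop _ _]cat1s perm_catCA; apply: perm_refl.
Qed.

Lemma ev_pull T x0 s i (t : tree T) A : uniq s -> i < size s ->
  ev s t A = if nth x0 s i \in A then ev (del i s) (pull1 i t) A
             else ev (del i s) (pull0 i t) A.
Proof.
elim: s i t => [//|y s IH] [|i] t /= /andP[ys us] lt_i.
  rewrite ev_cons /del /= drop0.
  by case: t.
have -> : del i.+1 (y :: s) = y :: del i s by [].
rewrite 3!ev_cons !(IH i) //.
by case: t => [x|a b] /=; case: (y \in A); case: (nth x0 s i \in A).
Qed.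

Lemma relabelsP n sg t u s : uniq s -> size s = n -> relabels n sg t u ->
  perm_eq (relabel sg s) s /\ forall A, ev (relabel sg s) u A = ev s t A.
Proof.
elim: n sg t u s => [|n IH] [|i sg] t u s us ss /= same;
  try by case: s us ss same => // *; split=> // A; apply/esym/eqP;
    rewrite -[_ == _](ev_map2 eqn); apply: all_leavesE.
case: s us ss same => [//|x0 s0]; set s := x0 :: s0 => us ss /andP[/andP[lt_i r0] r1].
have {lt_i} lt_i : i < size s by rewrite ss -ltbE.
have pd := perm_del x0 lt_i.
have /= /andP[xd ud] : uniq (nth x0 s i :: del i s) by rewrite (perm_uniq pd).
have sd : size (del i s) = n by move: (perm_size pd); rewrite ss => -[].
have [p0 e0] := IH _ _ _ _ ud sd r0; have [_ e1] := IH _ _ _ _ ud sd r1.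
split; first by apply: perm_trans pd; rewrite perm_cons.
by move=> A; rewrite ev_cons e0 e1 [RHS](ev_pull x0 _ _ us lt_i).
Qed.

End Relabelling.

(** * The catalogue step *)

(** Position of an entry in a list cut into pieces, and the relabelling that
leads to it. *)
Definition certificate : Type := nat * nat * seq nat.

Definition certified n (next : seq (seq (tree nat))) t (c : certificate) : bool :=
  let: (i, j, sg) := c in
  if ohead (drop j (nth [::] next i)) is Some u then relabels n sg t u else false.

Definition step_ok n (cat : seq (tree nat)) (next : seq (seq (tree nat)))
    (cs : seq (seq certificate)) : bool :=
  all2 (fun t => all2 (fun d => certified n.+1 next (extend t d))
                      (free_extensions n t)) cat cs.

Definition complete n (cat : seq (tree nat)) : Prop :=
  forall (E : finType) (M : matroid E) (s : seq E),
  simple_matroid M -> uniq s -> size s = n ->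
  exists s' t, [/\ perm_eq s' s, t \in cat, fits n t &
    forall A : {set E}, A \subset s -> ev s' t A = rk M A].

Lemma all2_mem (S T : eqType) (r : S -> T -> bool) s t x :
  all2 r s t -> x \in s -> exists2 y, y \in t & r x y.
Proof.
elim: s t => [//|a s IH] [//|b t] /= /andP[rab rst]; rewrite inE => /predU1P[->|xs].
  by exists b; rewrite // inE eqxx.
by have [y yt rxy] := IH _ rst xs; exists y; rewrite // inE yt orbT.
Qed.

Section FreeElement.
Variables (E : finType) (M : matroid E).
Implicit Types (s : seq E) (A : {set E}) (x e : E).

Definition mass s x := \sum_(A : {set E} | A \subset s) rk M (x |: A).

(** The masses of [x] and [e] have in common the contributions of the sets
containing both; what remains compares how many sets avoiding both elements
each of them raises. *)
Lemma mass_growth e x s : uniq [:: e, x & s] ->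
  mass [:: e, x & s] x <= mass [:: e, x & s] e ->
  \sum_(A : {set E} | A \subset s) (rk M A < rk M (x |: A)) <=
  \sum_(A : {set E} | A \subset s) (rk M A < rk M (e |: A)).
Proof.
move=> /= /and3P[exs xs us]; rewrite /mass !big_subset_cons //=.
have eU y A : y |: (y |: A) = y |: A by rewrite setUA setUid.
have grow y : \sum_(A : {set E} | A \subset s) rk M (y |: A) =
    \sum_(A : {set E} | A \subset s) rk M A +
    \sum_(A : {set E} | A \subset s) (rk M A < rk M (y |: A)).
  by rewrite -big_split; apply: eq_bigr => A _; apply: rk_setU1.
have congr_sum (f g : {set E} -> {set E}) : f =1 g ->
    \sum_(A : {set E} | A \subset s) rk M (f A) =
    \sum_(A : {set E} | A \subset s) rk M (g A).
  by move=> fg; apply: eq_bigr => A _; rewrite fg.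
rewrite (congr_sum (fun A => x |: (x |: A)) _ (eU x)).
rewrite (congr_sum (fun A => e |: (e |: A)) _ (eU e)).
rewrite (congr_sum (fun A => e |: (e |: (x |: A))) (fun A => e |: (x |: A))) //.
rewrite (congr_sum (fun A => x |: (e |: (x |: A))) (fun A => e |: (x |: A))); last first.
  by move=> A; rewrite setUCA eU.
rewrite (congr_sum (fun A => x |: (e |: A)) (fun A => e |: (x |: A))); last first.
  by move=> A; rewrite setUCA.
have halve a b c d : a + b + (a + b) + (d + d) <= a + c + d + (a + c + d) -> b <= c.
  lia.
by rewrite /= !grow; apply: halve.
Qed.

Lemma mass_perm s1 s2 x : s1 =i s2 -> mass s1 x = mass s2 x.
Proof. by move=> e12; apply: eq_bigl => A; apply: eq_subset_r. Qed.

End FreeElement.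

Section CatalogueStep.
Variables (n : nat) (cat : seq (tree nat)) (next : seq (seq (tree nat))).
Variable cs : seq (seq certificate).

(** The first element of the listing is split off, so that the condition of
maximal mass can be compared with the filter of [free_extensions]. *)
Lemma free_extensions_complete (E : finType) (M : matroid E) e s t :
  simple_matroid M -> uniq (e :: s) -> fits (size s) t ->
  (forall x, x \in s -> mass M (e :: s) x <= mass M (e :: s) e) ->
  (forall A : {set E}, A \subset s -> ev s t A = rk M A) ->
  exists d, [/\ d \in free_extensions (size s) t, fits (size s) d &
    forall A : {set E}, A \subset s -> ev s d A = (rk M A < rk M (e |: A))].
Proof.
move=> simM us ft e_free tE; have /andP[es us'] := us.
have set0U A : set0 :|: A = A :> {set E} by rewrite set0U.
have get (s' : seq E) t' : uniq s' -> e \notin s' -> fits (size s') t' ->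
    (forall A : {set E}, A \subset s' -> ev s' t' A = rk M A) ->
    exists d, [/\ d \in extensions 0 t', fits (size s') d &
    forall A : {set E}, A \subset s' -> ev s' d A = (rk M A < rk M (e |: A))].
  move=> us1 es1 ft' tE'.
  have [] := @extensions_complete E M simM e s' t' set0 0 us1 ft' _ (cards0 _) _ es1.
  - by move=> x _; rewrite inE.
  - by rewrite inE.
  - by move=> A As; rewrite set0U tE'.
  move=> d [d_in fd dE]; exists d; split=> // A As.
  by rewrite dE // set0U.
case: t s us us' es ft e_free tE => [k|a b] s us us' es ft e_free tE.
  exact: get.
case: s us us' es ft e_free tE => [//|x s] us /= /andP[xs us'].
rewrite inE => /norP[ex es] /andP[fa fb] e_free tE.
have sub_cons (A : {set E}) : A \subset s -> A \subset x :: s.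
  by move=> As; apply/subsetP => y /(subsetP As) ys; rewrite inE ys orbT.
have aE (A : {set E}) : A \subset s -> ev s a A = rk M A.
  move=> As; rewrite -tE ?sub_cons // ev_cons /=.
  by case: ifP => // /(subsetP As); rewrite (negPf xs).
have bE (A : {set E}) : A \subset s -> ev s b A = rk M (x |: set0 :|: A).
  move=> As; rewrite setU0 -tE ?ev_cons ?setU11 ?ev_setU1 //.
  by apply/subsetP => y; rewrite !inE => /orP[->//|/(subsetP As)->]; rewrite orbT.
have [c [c_in fc cE]] := get s a us' es fa aE.
have [] := @extensions_complete E M simM e s b (x |: set0) 1 us' fb _ _ _ es bE.
- by move=> y ys; rewrite !inE orbF; apply: contraNneq xs => <-.
- by rewrite setU0 cards1.
- by rewrite !inE orbF.
move=> d [d_in fd dE].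
have [||||d' [d'_in fd' d'E]] :=
    @merge_complete E M [seq c <- extensions 0 a | Nat.leb (weight (size s) (growth a b)) (weight (size s) c)] _
      e x s a b set0 c d _ fa fb _ bE _ fc _ d_in fd dE.
- by rewrite /= xs.
- by move=> A As; rewrite set0U aE.
- rewrite mem_filter c_in andbT lebE !weightE ?fits_map2 //.
  rewrite (eq_bigr (fun A : {set E} => nat_of_bool (rk M A < rk M (x |: A)))); last first.
    by move=> A As; rewrite ev_map2 aE // bE // ltbE setU0.
  rewrite [X in _ <= X](eq_bigr (fun A : {set E} => nat_of_bool (rk M A < rk M (e |: A)))); last first.
    by move=> A As; rewrite cE.
  by apply: mass_growth => //; apply: e_free; rewrite mem_head.
- by move=> A As; rewrite set0U cE.
by exists d'; split=> // A As; rewrite d'E // set0U.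
Qed.

(** The freest element of the matroid is taken as the new one; its deletion is
simple, hence listed, and the extension found from it is relabelled into the
next list. *)
Lemma step_complete : complete n cat -> step_ok n cat next cs ->
  all (fits n.+1) (flatten next) -> complete n.+1 (flatten next).
Proof.
move=> catP ok fit_next E M s simM us ss.
have [x0 x0s] : exists x, x \in s by case: s ss {us} => // x; exists x; rewrite mem_head.
have [e es e_max] : exists2 e, e \in s & forall x, x \in s -> mass M s x <= mass M s e.
  by case: (@arg_maxnP _ x0 (mem s) (mass M s) x0s) => e es e_max; exists e.
have pe := perm_to_rem es.
have ur : uniq (rem e s) by rewrite rem_uniq.
have sr : size (rem e s) = n by rewrite size_rem // ss.
have [s' [t [ps' t_in ft tE]]] := catP E M _ simM ur sr.
have ps : perm_eq (e :: s') s by rewrite (perm_trans _ (_ : perm_eq (e :: rem e s) s)) ?perm_cons // perm_sym.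
have us' : uniq (e :: s') by rewrite (perm_uniq ps).
have ss' : size s' = n by rewrite (perm_size ps').
have tE' (A : {set E}) : A \subset s' -> ev s' t A = rk M A.
  by move=> As; apply: tE; rewrite -(eq_subset_r (perm_mem ps')).
have [||d [d_in fd dE]] := @free_extensions_complete E M e s' t simM us' _ _ tE'.
- by rewrite ss'.
- move=> x xs'; rewrite !(mass_perm M _ (perm_mem ps)); apply: e_max.
  by rewrite -(perm_mem ps) inE xs' orbT.
have [cs1 cs1_in ok1] := all2_mem ok t_in.
rewrite ss' in d_in; have [[[i j] sg] _] := all2_mem ok1 d_in.
rewrite /certified; case Eu: ohead => [u|//] lab.
have u_in : u \in flatten next.
  apply/flattenP; exists (nth [::] next i).
    by apply: mem_nth; rewrite ltnNge; apply/negP => le_i; rewrite nth_default in Eu.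
  by apply: (@mem_drop j); case: drop Eu => // v l [->]; rewrite mem_head.
have se : size (e :: s') = n.+1 by rewrite /= ss'.
have [pr rE] := relabelsP us' se lab.
exists (relabel sg (e :: s')), u; split=> //.
- exact: perm_trans pr ps.
- exact: (allP fit_next).
move=> A As; rewrite rE ev_cons /=.
have As' : A :\ e \subset s'.
  apply/subsetP => y; rewrite !inE => /andP[ye /(subsetP As)].
  by rewrite -(perm_mem ps) inE (negPf ye).
have /andP[es' _] := us'.
case: ifPn => [eA|eA]; last first.
  by rewrite tE' //; apply: (subset_trans _ As'); rewrite subsetD1 subxx eA.
rewrite -(setD1K eA) ev_setU1 // ev_map2 dE // tE' //.
by rewrite [RHS]rk_setU1; case: (_ < _); rewrite ?addn1 ?addn0.
Qed.

End CatalogueStep.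

(** * The matroid of a rank function *)

(** Normalization, unit growth and submodularity, both for one element at a time,
characterize rank functions; these are the conditions that a tree can check
node by node. *)
Section RankFunction.
Variables (E : finType) (r : {set E} -> nat).
Hypothesis r0 : r set0 = 0.
Hypothesis r_step : forall x A, r (x |: A) = r A + (r A < r (x |: A)).
Hypothesis r_sub : forall x y A,
  r (y |: A) < r (x |: (y |: A)) -> r A < r (x |: A).
Implicit Types (x y : E) (A B I J : {set E}).

Let union (l : seq E) A := [set x in l] :|: A.

Let unionC x l A : union (x :: l) A = x |: union l A.
Proof. by rewrite /union set_cons setUA. Qed.

Let unionE A B : A \subset B -> B = union (enum (B :\: A)) A.
Proof.
move=> AB; apply/setP => x; rewrite !inE mem_enum inE.
by case: (boolP (x \in A)) => [/(subsetP AB)->|_]; rewrite ?orbT ?orbF.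
Qed.

Let r_grow_sub x A B : A \subset B -> r B < r (x |: B) -> r A < r (x |: A).
Proof.
move/unionE ->; elim: (enum _) => [|y l IH]; first by rewrite /union set_nil set0U.
by rewrite unionC => /r_sub.
Qed.

Let r_union l A : r A <= r (union l A) <= r A + size l.
Proof.
elim: l => [|x l IH]; first by rewrite /union set_nil set0U addn0 leqnn.
by move: IH; rewrite unionC r_step /=; case: (_ < _); lia.
Qed.

Let r_mono A B : A \subset B -> r A <= r B.
Proof. by move/unionE->; case/andP: (r_union (enum (B :\: A)) A). Qed.

Let r_card A B : A \subset B -> r B <= r A + #|B :\: A|.
Proof.
move=> AB; rewrite {1}(unionE AB) cardE.
by case/andP: (r_union (enum (B :\: A)) A).
Qed.

Let r_saturated A B : (forall x, x \in B -> r (x |: A) = r A) -> r (B :|: A) = r A.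
Proof.
move=> sat; have -> : B :|: A = union (enum B) A.
  by rewrite /union; congr (_ :|: _); apply/setP => x; rewrite inE mem_enum.
have : {subset enum B <= B} by move=> x; rewrite mem_enum.
elim: (enum B) => [|x l IH] lB; first by rewrite /union set_nil set0U.
rewrite unionC -[RHS]IH; last by move=> y yl; apply: lB; rewrite inE yl orbT.
rewrite r_step; case: ltnP => [/r_grow_sub|]; rewrite ?addn0 //.
by move=> /(_ _ (subsetUr _ _)); rewrite sat ?ltnn // lB ?mem_head.
Qed.

Definition rank_indep : {set {set E}} := [set I | r I == #|I|].

Lemma rank_indep0 : set0 \in rank_indep.
Proof. by rewrite inE r0 cards0. Qed.

Lemma rank_indepS I J : I \subset J -> J \in rank_indep -> I \in rank_indep.
Proof.
rewrite !inE => IJ /eqP rJ; rewrite eqn_leq.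
have := r_card (sub0set I); rewrite r0 add0n setD0 => -> /=.
by have := r_card IJ; rewrite rJ cardsD (setIidPr IJ); have := subset_leq_card IJ; lia.
Qed.

Lemma rank_indep_aug I J : I \in rank_indep -> J \in rank_indep -> #|I| < #|J| ->
  exists2 x, x \in J :\: I & x |: I \in rank_indep.
Proof.
rewrite !inE => /eqP rI /eqP rJ lt_IJ.
have [/exists_inP[x xJ gx]|] := boolP [exists x in J, r I < r (x |: I)].
  have xI : x \notin I.
    by apply: contraTN gx => xI; rewrite (setUidPr _) ?sub1set // ltnn.
  by exists x; rewrite ?inE ?xI // r_step gx cardsU1 xI rI addnC.
rewrite negb_exists_in => /forall_inP sat; have: r (J :|: I) = r I.
  by apply: r_saturated => x /sat/negPf gx; rewrite r_step gx addn0.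
by have := r_mono (subsetUl J I); rewrite rI rJ; lia.
Qed.

Definition rank_matroid : matroid E :=
  Matroid rank_indep0 rank_indepS rank_indep_aug.

Lemma rk_rank_matroid A : rk rank_matroid A = r A.
Proof.
have [J [Ji _ JA cJ]] := rk_extend (indep0 rank_matroid) (sub0set A).
have rJ : r J = #|J| by apply/eqP; move: Ji; rewrite inE.
rewrite -cJ -rJ -[in RHS](setUidPl JA); apply/esym/r_saturated => x xA.
rewrite r_step; case: ltnP; rewrite ?addn0 // => gx.
have xJ : x \notin J.
  by apply: contraTN gx => xJ; rewrite (setUidPr _) ?sub1set // ltnn.
have: x |: J \in indep rank_matroid by rewrite inE r_step gx cardsU1 xJ rJ addnC.
move=> /leq_rk/(_ (_ : _ \subset A)); rewrite subUset sub1set xA JA => /(_ isT).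
by rewrite cardsU1 xJ -cJ add1n ltnn.
Qed.

End RankFunction.

Definition grows01 (m n : nat) : bool := eqn m n || eqn m.+1 n.

(** At a node deciding [z]: adding [z] raises by 0 or 1, and the sets raised by
[z] are closed under subsets. *)
Fixpoint matroidal (t : tree nat) : bool :=
  match t with
  | Leaf _ => true
  | Node a b => all_leaves (map2 grows01 a b) <&&> decr (growth a b)
                <&&> matroidal a <&&> matroidal b
  end.

Definition small_sets_free n (t : tree nat) : bool :=
  let m0 := nseq n false in
  eqn (look t m0) 0 <&&>
  all (fun i => all (fun j => eqn (look t (setb (setb m0 j) i))
                                  (if eqn i j then 1 else 2)) (iota 0 n)) (iota 0 n).

Definition valid n (t : tree nat) : bool :=
  fits n t <&&> matroidal t <&&> small_sets_free n t.

Lemma exchange_growth k1 k2 k3 k4 : k4 = k2 + (k2 < k4) -> k3 = k1 + (k1 < k3) ->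
  (k2 < k4 -> k1 < k3) -> k3 < k4 -> k1 < k2.
Proof. by case: (k2 < k4) (k1 < k3) => [] [] -> -> // ?; lia. Qed.

Section MatroidalTree.
Variable E : finType.
Implicit Types (s : seq E) (A : {set E}) (x y : E).

Lemma matroidal_step s t x A : uniq s -> matroidal t -> x \in s ->
  ev s t (x |: A) = ev s t A + (ev s t A < ev s t (x |: A)).
Proof.
elim: s t => [//|z s IH] t /= /andP[zs us] mt.
have [xA _|xA] := boolP (x \in A).
  by rewrite (setUidPr _) ?sub1set // ltnn addn0.
have [ml mh] : matroidal (lo t) /\ matroidal (hi t).
  by case: t mt => [//|a b] /= /andP[/andP[_ ->] ->].
rewrite inE => /predU1P[xz|xs]; last first.
  have zx : (z \in x |: A) = (z \in A).
    by rewrite !inE; case: eqP zs => // ->; rewrite xs.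
  by rewrite !ev_cons zx; case: ifP => _; apply: IH.
rewrite !ev_cons -xz setU11 (negPf xA) ev_setU1 ?xz //.
case: t mt {ml mh} => [k _|a b /= /andP[/andP[/andP[ab _] _] _]].
  by rewrite /ev /= ltnn addn0.
have := all_leavesE (ind s A) ab; rewrite look_map2 /ev /grows01.
by rewrite !eqnE; lia.
Qed.

(** A node tests only pairs with its own element as the raising one.  The
condition is symmetric: when [y] is the element of the node, it follows by
counting the rank of [x |: (y |: A)] in two ways. *)
Lemma matroidal_sub s t x y A : uniq s -> matroidal t -> x \in s -> y \in s ->
  ev s t (y |: A) < ev s t (x |: (y |: A)) -> ev s t A < ev s t (x |: A).
Proof.
elim: s t => [//|z s IH] t us mt; have /andP[zs us'] := us.
have [ml mh] : matroidal (lo t) /\ matroidal (hi t).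
  by case: t mt => [//|a b] /= /andP[/andP[_ ->] ->].
have [yA|yA] := boolP (y \in A); first by rewrite [y |: A](setUidPr _) ?sub1set.
have [xA _ _|xA] := boolP (x \in A).
  by rewrite [x |: (y |: A)](setUidPr _) ?ltnn // sub1set !inE xA orbT.
have [-> _ _|xy] := eqVneq x y; first by rewrite setUA setUid ltnn.
have zU w (B : {set E}) : w \in s -> (z \in w |: B) = (z \in B).
  by move=> ws; rewrite !inE; case: eqP zs => // ->; rewrite ws.
have dg : decr (growth (lo t) (hi t)).
  by case: t mt {ml mh} => [k _|a b /= /andP[/andP[/andP[_ ->]]]]; rewrite //= /growth /= ltbE ltnn.
have gE (B : {set E}) : z \notin B ->
    ev s (growth (lo t) (hi t)) B = (ev (z :: s) t B < ev (z :: s) t (z |: B)).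
  by move=> zB; rewrite ev_map2 ltbE !ev_cons (negPf zB) setU11 ev_setU1.
rewrite !inE => /predU1P[xz|xs] /predU1P[yz|ys].
- by rewrite xz yz eqxx in xy.
- have zA : z \notin A by rewrite -xz.
  rewrite xz -!gE ?zU //; exact: ev_decr.
- have zA : z \notin A by rewrite -yz.
  have := ev_decr (x := x) (A := A) us' dg xs; rewrite !gE ?zU //.
  have := matroidal_step A us mt (mem_head z s).
  have := matroidal_step (x |: A) us mt (mem_head z s).
  rewrite yz [x |: (z |: A)]setUCA.
  exact: exchange_growth.
by rewrite !ev_cons !zU //; case: ifP => _; apply: IH.
Qed.

Lemma valid_simple s t : uniq s -> valid (size s) t ->
  ev s t set0 = 0 /\
  forall x y, x \in s -> y \in s -> ev s t (x |: (y |: set0)) = if x == y then 1 else 2.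
Proof.
move=> us /andP[_ /andP[/eqnP r0 /allP small]].
have i0 : ind s set0 = nseq (size s) false.
  by elim: s {us r0 small} => //= x s ->; rewrite inE.
split=> [|x y xs ys]; first by rewrite /ev i0.
have i_lt z : z \in s -> index z s \in iota 0 (size s).
  by move=> zs; rewrite mem_iota index_mem.
have /allP/(_ _ (i_lt y ys))/eqnP := small _ (i_lt x xs).
rewrite -i0 -!(ind_set_nth x) ?index_mem // !nth_index // /ev => ->.
rewrite -[eqn _ _]/(index x s == index y s); congr (if _ then _ else _).
by apply/eqP/eqP => [|-> //]; move/(congr1 (nth x s)); rewrite !nth_index.
Qed.

End MatroidalTree.

(** ** The matroid on ['I_8] of a valid tree *)

Section TreeMatroid.
Variable t : tree nat.

Definition s8 : seq 'I_8 := enum 'I_8.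

Lemma s8_uniq : uniq s8. Proof. exact: enum_uniq. Qed.
Lemma mem_s8 x : x \in s8. Proof. exact: mem_enum. Qed.
Lemma size_s8 : size s8 = 8. Proof. by rewrite size_enum_ord. Qed.

Hypothesis vt : valid 8 t.

Let vt' : valid (size s8) t. Proof. by rewrite size_s8. Qed.
Let mt : matroidal t. Proof. by case/andP: vt => /andP[]. Qed.

Let r := ev s8 t.

Let r0 : r set0 = 0. Proof. by case: (valid_simple s8_uniq vt'). Qed.

Let r_step x A : r (x |: A) = r A + (r A < r (x |: A)).
Proof. exact/(matroidal_step A s8_uniq)/mem_s8. Qed.

Let r_sub x y A : r (y |: A) < r (x |: (y |: A)) -> r A < r (x |: A).
Proof. exact: (matroidal_sub s8_uniq mt (mem_s8 x) (mem_s8 y)). Qed.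

Definition valid_matroid : matroid 'I_8 := rank_matroid r0 r_step r_sub.

Lemma rk_valid_matroid A : rk valid_matroid A = ev s8 t A.
Proof. exact: rk_rank_matroid. Qed.

Lemma valid_matroid_simple : simple_matroid valid_matroid.
Proof.
have [_ small] := valid_simple s8_uniq vt'.
apply/andP; split; apply/forallP => x.
  rewrite rk_indep rk_valid_matroid cards1.
  by have := small x x (mem_s8 x) (mem_s8 x); rewrite eqxx setUA setUid setU0 => ->.
apply/forallP => y; apply/implyP => xy; rewrite rk_indep rk_valid_matroid cards2 xy.
by have := small x y (mem_s8 x) (mem_s8 y); rewrite (negPf xy) setU0 => ->.
Qed.

End TreeMatroid.

(** * Isomorphism *)

Section Isomorphism.
Variables (E F : finType) (M : matroid E) (N : matroid F).

Lemma matroid_iso_rk (f : E -> F) : bijective f ->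
  (forall I : {set E}, (f @: I \in indep N) = (I \in indep M)) ->
  forall A : {set E}, rk N (f @: A) = rk M A.
Proof.
move=> [g fK gK] fI A; apply/eqP; rewrite eqn_leq; apply/andP; split.
  apply/bigmax_leqP => J /andP[Ji JA].
  have eJ : J = f @: (g @: J) by rewrite -imset_comp (eq_imset _ (gK : f \o g =1 id)) imset_id.
  rewrite eJ (card_imset _ (can_inj fK)); apply: leq_rk; first by rewrite -fI -eJ.
  apply/subsetP => x /imsetP[y yJ ->]; have /imsetP[z zA ->] := subsetP JA y yJ.
  by rewrite fK.
apply/bigmax_leqP => I /andP[Ii IA].
rewrite -(card_imset _ (can_inj fK)); apply: leq_rk; first by rewrite fI.
exact: imsetS.
Qed.

(** Matching the two listings position by position carries one rank function to
the other. *)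
Lemma same_tree_iso (s : seq E) (s' : seq F) (t : tree nat) :
  uniq s -> (forall x, x \in s) -> uniq s' -> (forall y, y \in s') ->
  size s = size s' ->
  (forall A, ev s t A = rk M A) -> (forall B, ev s' t B = rk N B) ->
  matroid_iso M N.
Proof.
move=> us ms us' ms' ss tM tN.
case: s us ms ss tM => [|x0 s0] us ms ss tM.
  have noE (x : E) : False by have := ms x.
  exists (fun x => match noE x with end).
    have noF (y : F) : False by have := ms' y; case: s' ss {us' ms' tN}.
    by exists (fun y => match noF y with end) => x; case: (noE x) || case: (noF x).
  move=> I; rewrite !rk_indep card_imset => [|x]; last by case: (noE x).
  rewrite -tM -tN; congr (_ == _).
  by case: s' ss {us' ms' tN}.
set s := x0 :: s0 in us ms ss tM *.
have [y0 y0s] : exists y0, y0 \in s'.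
  by case: s' ss {us' ms' tN} => // y s' _; exists y; rewrite mem_head.
pose f x := nth y0 s' (index x s); pose g y := nth x0 s (index y s').
have fK : cancel f g.
  by move=> x; rewrite /f /g index_uniq -?ss ?index_mem // nth_index.
have gK : cancel g f.
  by move=> y; rewrite /f /g index_uniq ?ss ?index_mem // nth_index.
exists f => [|I]; first by exists g.
rewrite !rk_indep (card_imset _ (can_inj fK)) -tM -tN; congr (_ == _).
rewrite /ev; congr look; rewrite /ind.
have es' : s' = map f s.
  apply: (@eq_from_nth _ y0); rewrite ?size_map // => i lt_i.
  by rewrite (nth_map x0) ?ss // /f index_uniq ?ss.
rewrite es' -map_comp; apply: eq_map => x /=.
exact: (mem_imset _ _ (can_inj fK)).
Qed.

End Isomorphism.

Import GRing.Theory.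

(** * An isomorphism invariant *)

Inductive f3 := F0 | F1 | F2.

Definition add3 (x y : f3) : f3 :=
  match x, y with
  | F0, _ => y
  | F1, F0 => F1 | F1, F1 => F2 | F1, F2 => F0
  | F2, F0 => F2 | F2, F1 => F0 | F2, F2 => F1
  end.

Definition opp3 (x : f3) : f3 := match x with F0 => F0 | F1 => F2 | F2 => F1 end.

Fixpoint mod3 (n : nat) : f3 :=
  match n with 0 => F0 | 1 => F1 | 2 => F2 | m.+3 => mod3 m end.

Lemma add3A : associative add3. Proof. by do 3!case. Qed.
Lemma add3C : commutative add3. Proof. by do 2!case. Qed.
Lemma add30 : left_id F0 add3. Proof. by []. Qed.
HB.instance Definition _ := Monoid.isComLaw.Build f3 F0 add3 add3A add3C add30.

Lemma opp3D : {morph opp3 : x y / add3 x y}. Proof. by do 2!case. Qed.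

(** The transform of a function on subsets with values in the field of three
elements, against the characters with values [1] and [-1]. *)
Fixpoint fourier n (t : tree nat) : tree f3 :=
  if n is n'.+1 then
    let a := fourier n' (lo t) in
    let b := fourier n' (hi t) in
    Node (map2 add3 a b) (map2 (fun x y => add3 x (opp3 y)) a b)
  else Leaf (mod3 (look t [::])).

Fixpoint total n (u : tree N) : N :=
  if n is n'.+1 then N.add (total n' (lo u)) (total n' (hi u)) else look u [::].

(** Any function of the rank and of the Fourier coefficient leads to an
invariant; the powers of 2, 5 and 11 are a choice for which the invariant
separates the matroids on eight elements. *)
Definition hash (r : nat) (g : f3) : N :=
  iter r (N.mul match g with F0 => 2%num | F1 => 5%num | F2 => 11%num end) 1%num.

Definition invariant n (t : tree nat) : N := total n (map2 hash t (fourier n t)).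

Section Invariant.
Variable E : finType.
Implicit Types (s : seq E) (A B : {set E}).

(** [x] times the character [(-1) ^ #|A :&: B|]. *)
Definition chi A B (x : f3) : f3 := if odd #|A :&: B| then opp3 x else x.

Lemma ev_fourier s t A : uniq s ->
  ev s (fourier (size s) t) A =
  \big[add3/F0]_(B : {set E} | B \subset s) chi A B (mod3 (ev s t B)).
Proof.
elim: s t => [|x s IH] t.
  by rewrite big_subset_nil /chi setI0 cards0.
move=> /= /andP[xs us]; rewrite (big_subset_cons _ _ xs) ev_cons /=.
have lhs : \big[add3/F0]_(B : {set E} | B \subset s) chi A B (mod3 (ev (x :: s) t B)) =
    ev s (fourier (size s) (lo t)) A.
  rewrite IH //; apply: eq_bigr => B Bs; rewrite ev_cons.
  by case: ifP => // /(subsetP Bs); rewrite (negPf xs).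
have rhs : \big[add3/F0]_(B : {set E} | B \subset s)
      chi A (x |: B) (mod3 (ev (x :: s) t (x |: B))) =
    (if x \in A then opp3 else id) (ev s (fourier (size s) (hi t)) A).
  rewrite IH // (_ : (if x \in A then opp3 else id) _ =
    \big[add3/F0]_(B : {set E} | B \subset s)
      (if x \in A then opp3 else id) (chi A B (mod3 (ev s (hi t) B)))); last first.
    by case: ifP => // _; apply: (big_morph _ opp3D).
  apply: eq_bigr => B Bs; rewrite ev_cons setU11 ev_setU1 // /chi setIUr.
  have xB : x \notin B by apply: contra xs; apply: (subsetP Bs).
  have [xA|xA] := boolP (x \in A).
    rewrite (setIidPr (_ : [set x] \subset A)) ?sub1set //.
    by rewrite cardsU1 !inE (negPf xB) andbF /=; case: odd => //=; case: mod3.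
  rewrite (_ : A :&: [set x] = set0) ?set0U //.
  by apply/setP => y; rewrite !inE; case: eqP => [->|]; rewrite ?(negPf xA) ?andbF.
by rewrite lhs rhs; case: ifP => _; rewrite ev_map2.
Qed.

Lemma totalE s (u : tree N) : uniq s ->
  total (size s) u = (\sum_(A : {set E} | A \subset s) ev s u A)%R.
Proof.
elim: s u => [|x s IH] u; first by rewrite big_subset_nil.
move=> /= /andP[xs us]; rewrite (big_subset_cons _ _ xs) !IH //=.
congr (_ + _)%R; apply: eq_bigr => A As; rewrite ev_cons.
  by case: ifP => // /(subsetP As); rewrite (negPf xs).
by rewrite setU11 ev_setU1.
Qed.

Definition rank_fourier (M : matroid E) A : f3 :=
  \big[add3/F0]_(B : {set E}) chi A B (mod3 (rk M B)).

Definition rank_invariant (M : matroid E) : N :=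
  (\sum_(A : {set E}) hash (rk M A) (rank_fourier M A))%R.

Lemma invariantE (M : matroid E) s t : uniq s -> (forall x, x \in s) ->
  (forall A, ev s t A = rk M A) -> invariant (size s) t = rank_invariant M.
Proof.
move=> us ms tE; rewrite /invariant totalE //; apply: eq_big => [A|A _].
  by apply/subsetP => x _.
rewrite ev_map2 tE ev_fourier //; congr hash; apply: eq_big => [B|B _].
  by apply/subsetP => x _.
by rewrite tE.
Qed.

End Invariant.

Lemma rank_invariant_iso (E F : finType) (M : matroid E) (N : matroid F) :
  matroid_iso M N -> rank_invariant M = rank_invariant N.
Proof.
case=> f fbij fI; have fr := matroid_iso_rk fbij fI.
have f_inj := bij_inj fbij.
have fb : bijective (fun A : {set E} => f @: A).
  case: fbij => g fK gK; exists (fun B : {set F} => g @: B) => A;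
    rewrite -imset_comp -[RHS]imset_id; exact: eq_imset.
rewrite /rank_invariant [RHS](reindex (fun A : {set E} => f @: A)) /=; last first.
  exact: onW_bij.
apply: eq_bigr => A _; rewrite fr; congr hash.
rewrite /rank_fourier [RHS](reindex (fun A : {set E} => f @: A)) /=; last first.
  exact: onW_bij.
apply: eq_bigr => B _; rewrite fr /chi -imsetI ?card_imset //.
by move=> x y _ _; apply: f_inj.
Qed.

(** * Words of operators as functions on subsets *)

Section Words.
Local Open Scope ring_scope.
Variables (R : realFieldType) (E : finType) (M : matroid E).
Notation V := (flat_space R M).
Notation r := (matroid_rank M).
Implicit Types (a : E) (x y : flat M) (X Y : {set E}) (F G : {set E} -> R).
Implicit Types (w : seq (option E)) (u v : V) (k j : nat).

Definition cl X : flat M := Flat (closure_flat M X).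

Lemma rk_cl X : rk M (cl X) = rk M X. Proof. exact: rk_closure. Qed.

Lemma cl_flat x : cl x = x.
Proof. by apply/val_inj/eqP/flat_setP. Qed.

Lemma cl_setU X Y : cl (X :|: cl Y) = cl (X :|: Y).
Proof.
have sub (Z T : {set E}) : Z \subset T -> Z \subset mclosure M T.
  by move=> ZT; apply: subset_trans ZT (sub_closure _ _).
apply/val_inj/eqP; rewrite eqEsubset /=.
apply/andP; split; rewrite closure_sub ?closure_flat // subUset sub ?subsetUl //=.
  exact/closure_mono/subsetUr.
exact: subset_trans (sub_closure M Y) (sub _ _ (subsetUr _ _)).
Qed.

Lemma rk_clU X Y : rk M (X :|: cl Y) = rk M (X :|: Y).
Proof. by rewrite -rk_cl cl_setU rk_cl. Qed.

Definition closed F := forall X, F (cl X) = F X.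

Lemma closed_cl F X Y : closed F -> cl X = cl Y -> F X = F Y.
Proof. by move=> cF e; rewrite -cF e cF. Qed.

Definition step a F X : R := if (rk M X < rk M (a |: X))%N then F (a |: X) else 0.

Definition raising X : {set E} := [set a | (rk M X < rk M (a |: X))%N].

Definition avg F X : R := (\sum_a step a F X) / #|raising X|%:R.

Lemma closed_step a F : closed F -> closed (step a F).
Proof.
move=> cF X; rewrite /step rk_clU rk_cl; case: ifP => // _.
by apply: closed_cl => //; apply: cl_setU.
Qed.

Lemma closed_avg F : closed F -> closed (avg F).
Proof.
move=> cF X; rewrite /avg; congr (_ / _%:R).
  by apply: eq_bigr => a _; apply: closed_step.
by apply: eq_card => a; rewrite !inE rk_clU rk_cl.
Qed.

(** The function on all subsets described by a word: letters are applied from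
right to left to the indicator of full rank, [Some a] being the substitution of
[a] and [None] the average.  Working on subsets instead of flats avoids
computing joins. *)
Fixpoint wf w X : R :=
  match w with
  | [::] => (rk M X == r)%:R
  | Some a :: w' => step a (wf w') X
  | None :: w' => avg (wf w') X
  end.

Lemma closed_wf w : closed (wf w).
Proof.
elim: w => [|[a|] w IH] X; first by rewrite /= rk_cl.
  exact: closed_step.
exact: closed_avg.
Qed.

Lemma step_rank a F j X : (forall Y, F Y != 0 -> rk M Y = j.+1) ->
  step a F X != 0 -> rk M X = j.
Proof.
move=> Fj; rewrite /step; case: ifP => [gX /Fj|_]; last by rewrite eqxx.
by rewrite rk_setU1 gX addn1 => -[].
Qed.

Lemma avg_rank F j X : (forall Y, F Y != 0 -> rk M Y = j.+1) ->
  avg F X != 0 -> rk M X = j.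
Proof.
move=> Fj; apply: contraNeq => rX; rewrite /avg big1 ?mul0r // => a _.
by apply: contra_neq_eq rX => /(step_rank Fj).
Qed.

Lemma wf_rank w X : wf w X != 0 -> (rk M X + size w)%N = r.
Proof.
elim: w X => [|o w IH] X /=.
  by rewrite addn0 pnatr_eq0 eqb0 negbK => /eqP.
have [ltwr|le_rw] := ltnP (size w) r.
  have Fj Y : wf w Y != 0 -> rk M Y = (r - (size w).+1).+1.
    by move/IH; lia.
  by case: o => [a /(step_rank Fj)|/(avg_rank Fj)] ->; lia.
have step0 a : step a (wf w) X = 0.
  rewrite /step; case: ifP => // gX; apply: contraTeq gX => /IH.
  by rewrite -leqNgt; lia.
by case: o => [a|]; rewrite ?step0 ?eqxx // /avg big1 ?mul0r ?eqxx.
Qed.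

(** Dividing coordinates by [beta] turns the adjoint operators into the
substitutions [step], in which [beta] no longer occurs. *)
Definition vec F : V := [ffun x => beta R x * F x].

Lemma lin_ext_diag (c : flat M -> R) u :
  lin_ext (fun x => c x *: flat_vec R x) u = [ffun x => c x * u x].
Proof.
apply/ffunP => x; rewrite lin_extE sum_ffunE (bigD1 x) //= big1 => [|y /negPf yx].
  by rewrite !ffunE eqxx addr0 -![_ *: _]/(_ * _) mulr1 mulrC.
by rewrite !ffunE eq_sym yx -![_ *: _]/(_ * _) !mulr0.
Qed.

Lemma raising_flat a x : (rk M x < rk M (a |: x))%N = (a \notin x).
Proof.
rewrite rk_setU1_gt; congr (~~ _); rewrite -[in RHS](cl_flat x) inE.
by [].
Qed.

Lemma join_op_vec a F : closed F -> join_op_beta R M a (vec F) = vec (step a F).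
Proof.
move=> cF; apply/ffunP => x.
have := adjoint_betaP (join_op R M a) (vec F) (flat_vec R x).
rewrite inner_beta_vecr lin_ext_vec -/(join_op_beta R M a).
move/(canRL (divfK (beta_neq0 R x))) => ->; rewrite [RHS]ffunE mulrC; congr (_ * _).
rewrite le_atom /step raising_flat if_neg; case: ifP => _.
  by rewrite /inner_beta big1 // => y _; rewrite !ffunE mulr0 mul0r.
rewrite inner_beta_vecr ffunE mulrC mulKf ?beta_neq0 //.
by rewrite -[RHS]cF setUC -cl_setU.
Qed.

Lemma sum_step F X : \sum_a step a F X = \sum_(a in raising X) F (a |: X).
Proof.
rewrite [RHS]big_mkcond; apply: eq_bigr => a _.
by rewrite inE.
Qed.

(** On vectors supported in rank [j.+1], [K_op] is the scalar [j.+1], and the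
normalization in [Sinv_op] counts the elements raising a flat. *)
Lemma D_vec F j : closed F -> (forall Y, F Y != 0 -> rk M Y = j.+1) ->
  D_beta R M (vec F) = j.+1%:R *: vec (avg F).
Proof.
move=> cF Fj; rewrite /D_beta !comp_lfunE.
have -> : K_op R M (vec F) = j.+1%:R *: vec F.
  rewrite /K_op lin_ext_diag /flat_rk; apply/ffunP => x; rewrite !ffunE.
  have [->|/Fj ->] := eqVneq (F x) 0; first by rewrite !mulr0 scaler0.
  by [].
rewrite linearZ linearZ; congr (_ *: _); rewrite /= /U_beta sum_lfunE.
under eq_bigr do rewrite join_op_vec //.
pose c x : R := if (x < \top)%O then (num_atoms_not_below x)%:R^-1 else 0.
have -> : Sinv_op R M = lin_ext (fun x => c x *: flat_vec R x).
  apply/lfunP => u; rewrite !lin_extE; apply: eq_bigr => x _.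
  by rewrite /c; case: ifP; rewrite ?scale0r.
rewrite lin_ext_diag; apply/ffunP => x; rewrite !ffunE sum_ffunE /c /avg.
under eq_bigr do rewrite ffunE.
rewrite -mulr_sumr mulrCA; congr (_ * _).
have rx : raising x = ~: x by apply/setP => a; rewrite !inE raising_flat.
have [xT|] := boolP (x < \top)%O.
  rewrite mulrC /num_atoms_not_below; congr (_ / _%:R).
  rewrite rx [RHS]cardsCs setCK; congr (_ - _)%N; apply: eq_card => a.
  by rewrite inE le_atom.
rewrite lt_neqAle lex1 andbT negbK => /eqP ->.
by rewrite sum_step big1 ?mul0r // => a; rewrite inE setUT ltnn.
Qed.

Lemma top_vecE : top_vec R M = vec (wf [::]).
Proof.
apply/ffunP => x; rewrite /top_vec /layer_vec sum_ffunE ffunE /= /flat_rk.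
case: eqP => [rx|rx]; last first.
  rewrite mulr0 big1 // => y /eqP ry; rewrite !ffunE.
  by case: eqP => [xy|_]; [case: rx; rewrite xy | rewrite [_ *: _]mulr0].
rewrite (bigD1 x) ?rx //= big1 => [|y /andP[_ /negPf yx]].
  by rewrite !ffunE eqxx addr0.
by rewrite !ffunE eq_sym yx [_ *: _]mulr0.
Qed.

Lemma C_beta_mem w : (size w <= r)%N -> vec (wf w) \in C_beta R M (size w).
Proof.
elim: w => [|[a|] w IH] /= sw; first by rewrite top_vecE memv_line.
  rewrite -join_op_vec; last exact: closed_wf.
  apply: (subvP (addvSr _ _)); apply: (subvP (sumv_sup a _ (subvv _))) => //.
  by apply: memv_img; apply: IH; apply: ltnW.
have Fj Y : wf w Y != 0 -> rk M Y = (r - (size w).+1).+1 by move/wf_rank; lia.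
rewrite -[vec _]scale1r -(@mulVf _ (r - (size w).+1).+1%:R) ?pnatr_eq0 // -scalerA.
rewrite -(D_vec (closed_wf w) Fj); apply: memvZ; apply: (subvP (addvSl _ _)).
by apply: memv_img; apply: IH; apply: ltnW.
Qed.

Lemma img_preim (f : 'End(V)) (U : {vspace V}) : (f @: (f @^-1: U) <= U)%VS.
Proof. by apply/subvP => _ /memv_imgP[u uU ->]; rewrite memv_preim. Qed.

(** With [C_beta_mem]: [C_beta R M k] is the span of the words of length [k]. *)
Lemma C_beta_min k (U : {vspace V}) : (k <= r)%N ->
  (forall w, size w = k -> vec (wf w) \in U) -> (C_beta R M k <= U)%VS.
Proof.
elim: k U => [|k IH] U le_k wU /=.
  by rewrite -memvE top_vecE; apply: wU.
rewrite subv_add; apply/andP; split.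
  apply: subv_trans (limgS _ (IH (D_beta R M @^-1: U)%VS (ltnW le_k) _)) _.
    move=> w sw; rewrite -memv_preim (D_vec (closed_wf w) (j := r - k.+1)).
      by apply/memvZ/(wU (None :: w)); rewrite /= sw.
    by move=> Y /wf_rank; lia.
  exact: img_preim.
apply/subv_sumP => a _.
apply: subv_trans (limgS _ (IH (join_op_beta R M a @^-1: U)%VS (ltnW le_k) _)) _.
  move=> w sw; rewrite -memv_preim join_op_vec; last exact: closed_wf.
  by apply: (wU (Some a :: w)); rewrite /= sw.
exact: img_preim.
Qed.

(** ** The commuting part *)

Definition lword (l : seq E) : seq (option E) := map Some l.

(** A word without average pairs a set with a list of elements: its value is 1
when the list is a basis of a complement. *)
Lemma wf_lword l X : wf (lword l) X =
  ((rk M X + size l == r) && (rk M (X :|: [set a in l]) == r))%N%:R.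
Proof.
elim: l X => [|a l IH] X /=; first by rewrite addn0 set_nil setU0 andbb.
have eqU : a |: X :|: [set b in l] = X :|: [set b in a :: l].
  by rewrite set_cons setUCA setUA.
rewrite /step; case: ifP => gX.
  by rewrite IH eqU rk_setU1 gX addn1 addSnnS.
rewrite (_ : _ && _ = false) //; apply/negbTE/negP => /andP[/eqP rX /eqP rXl].
have rk_list l' Y : (rk M (Y :|: [set b in l']) <= rk M Y + size l')%N.
  elim: l' => [|b l' IH']; first by rewrite set_nil setU0 addn0.
  by rewrite set_cons setUCA /= addnS (leq_trans (rk_setU1_leq _ _ _)) ?ltnS.
have := rk_list l (a |: X); rewrite eqU rXl rk_setU1 gX addn0 -rX /=; lia.
Qed.

Lemma foldl_join_op (t : seq E) u F : u = vec F -> closed F ->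
  exists2 G, closed G & foldl (fun u a => join_op_beta R M a u) u t = vec G /\
    forall X, G X = foldr step F (rev t) X.
Proof.
elim: t u F => [|a t IH] u F -> cF /=; first by exists F.
have [G cG [eG GE]] := IH _ _ (join_op_vec a cF) (closed_step a cF).
by exists G => //; split=> // X; rewrite GE rev_cons foldr_rcons.
Qed.

Lemma wf_foldr l : wf (lword l) = foldr step (wf [::]) l.
Proof. by elim: l => //= a l <-. Qed.

Lemma foldl_top (t : seq E) :
  foldl (fun u a => join_op_beta R M a u) (top_vec R M) t = vec (wf (lword (rev t))).
Proof.
have [G _ [-> GE]] := foldl_join_op t top_vecE (@closed_wf [::]).
by apply/ffunP => x; rewrite !ffunE GE wf_foldr.
Qed.

Lemma C_zero_mem l : vec (wf (lword l)) \in C_zero R M (size l).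
Proof.
have sl : size (rev l) == size l by rewrite size_rev.
rewrite -{1}[l]revK -foldl_top; apply: memv_span.
by apply/imageP; exists (Tuple sl).
Qed.

Lemma C_zero_min k (U : {vspace V}) :
  (forall l, size l = k -> vec (wf (lword l)) \in U) -> (C_zero R M k <= U)%VS.
Proof.
move=> lU; apply/span_subvP => _ /imageP[t _ ->]; rewrite foldl_top.
by apply: lU; rewrite size_rev size_tuple.
Qed.

Lemma C_zero_sub k : (k <= r)%N -> (C_zero R M k <= C_beta R M k)%VS.
Proof.
move=> le_k; apply: C_zero_min => l sl.
by rewrite -sl -(size_map Some l); apply: C_beta_mem; rewrite size_map sl.
Qed.

(** It is enough that one average of a word without average stays in the
commuting part: the [C_zero R M k] then satisfy the recursion of the
[C_beta R M k]. *)
Lemma C_beta_eq_zero :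
  (forall l, (size l < r)%N -> vec (wf (None :: lword l)) \in C_zero R M (size l).+1) ->
  forall k, (k <= r)%N -> C_beta R M k = C_zero R M k.
Proof.
move=> avgZ; elim=> [|k IH] le_k.
  apply/eqP; rewrite eqEsubv C_zero_sub // andbT; apply: C_beta_min => // w /size0nil->.
  exact: (C_zero_mem [::]).
apply/eqP; rewrite eqEsubv C_zero_sub // andbT /= IH ?(ltnW le_k) // subv_add.
apply/andP; split.
  apply: subv_trans (limgS _ (@C_zero_min _ (D_beta R M @^-1: C_zero R M k.+1)%VS _)) (img_preim _ _).
  move=> l sl; rewrite -memv_preim (D_vec (closed_wf _) (j := r - k.+1)).
    by apply: memvZ; rewrite -sl; apply: avgZ; rewrite sl.
  by move=> Y /wf_rank; rewrite size_map; lia.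
apply/subv_sumP => a _.
apply: subv_trans (limgS _ (@C_zero_min _ (join_op_beta R M a @^-1: C_zero R M k.+1)%VS _)) (img_preim _ _).
move=> l sl; rewrite -memv_preim join_op_vec; last exact: closed_wf.
by rewrite -sl; apply: (C_zero_mem (a :: l)).
Qed.

(** ** Coordinates and linear functionals *)

Definition flat_coord X u : R := u (cl X) / beta R (cl X).

Lemma flat_coord_vec F X : closed F -> flat_coord X (vec F) = F X.
Proof. by move=> cF; rewrite /flat_coord ffunE mulrC mulKf ?beta_neq0. Qed.

(** Functionals are given by evaluation at sets, as these are where words have
computable values. *)
Definition functional (z : seq ({set E} * R)) u : R^o :=
  \sum_(p <- z) p.2 * flat_coord p.1 u.

Lemma functional_linear z : linear (functional z).
Proof.
move=> c u v; rewrite /functional -[c *: \sum_(p <- z) _]/(c * _) mulr_sumr -big_split /=.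
apply: eq_bigr => p _; rewrite /flat_coord !ffunE -[_ *: _]/(_ * _).
by rewrite mulrDl mulrDr; congr (_ + _); rewrite -!mulrA mulrCA.
Qed.

HB.instance Definition _ z :=
  GRing.isLinear.Build R V R^o *:%R (functional z) (functional_linear z).

Definition annihilator z : {vspace V} := lker (linfun (functional z)).

Lemma memv_annihilator z u : (u \in annihilator z) = (functional z u == 0).
Proof. by rewrite memv_ker lfunE. Qed.

Lemma functional_vec z F : closed F ->
  functional z (vec F) = \sum_(p <- z) p.2 * F p.1.
Proof. by move=> cF; apply: eq_bigr => p _; rewrite flat_coord_vec. Qed.

End Words.

(** * Integer elimination *)

Definition isZ0 (x : Z) : bool := if x is Z0 then true else false.

Definition combine (x y : Z) (v w : seq Z) : seq Z :=
  [seq Z.sub (Z.mul x p.2) (Z.mul y p.1) | p <- zip v w].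

(** The division by the greatest common divisor keeps the entries small. *)
Definition eliminate (x : Z) (v w : seq Z) : seq Z :=
  if w is y :: w' then
    if isZ0 y then w' else
    let g := Z.gcd x y in combine (Z.div x g) (Z.div y g) v w'
  else [::].

Fixpoint independent n (rows : seq (seq Z)) : bool :=
  match rows, n with
  | [::], _ => true
  | (x :: v) :: rows', n'.+1 =>
    ~~ isZ0 x <&&> independent n' [seq eliminate x v w | w <- rows']
  | _, _ => false
  end.

Lemma isZ0E x : isZ0 x = (x == 0)%R. Proof. by case: x. Qed.

Section Bounds.
Local Open Scope ring_scope.
Variables (R : realFieldType) (E : finType) (M : matroid E).
Notation V := (flat_space R M).
Notation r := (matroid_rank M).
Implicit Types (x y : flat M) (X Y : {set E}) (u v : V) (U : {vspace V}).

Definition toR (z : Z) : R := (int_of_Z z)%:~R.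

Lemma toRB : {morph toR : x y / Z.sub x y >-> x - y}.
Proof. by move=> a b; rewrite /toR -[Z.sub a b]/(a - b) !rmorphB. Qed.
Lemma toRD : {morph toR : x y / Z.add x y >-> x + y}.
Proof. by move=> a b; rewrite /toR -[Z.add a b]/(a + b) !rmorphD. Qed.
Lemma toRM : {morph toR : x y / Z.mul x y >-> x * y}.
Proof. by move=> a b; rewrite /toR -[Z.mul a b]/(a * b) !rmorphM. Qed.
Lemma toR_eq0 z : (toR z == 0) = isZ0 z.
Proof. by rewrite /toR intr_eq0 isZ0E -(inj_eq (can_inj int_of_ZK) z 0). Qed.

(** [v] has the entries of [row] as coordinates at the flats [ys]. *)
Definition matches (ys : seq (flat M)) (row : seq Z) v : bool :=
  [seq toR z | z <- row] == [seq flat_coord y v | y : flat M <- ys].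

Lemma flat_coordD X u v : flat_coord X (u + v) = flat_coord X u + flat_coord X v.
Proof. by rewrite /flat_coord ffunE mulrDl. Qed.

Lemma flat_coordZ X c u : flat_coord X (c *: u) = c * flat_coord X u.
Proof. by rewrite /flat_coord ffunE mulrA. Qed.

Definition coord_ker X := annihilator M [:: (X, 1 : R)].

Lemma memv_coord_ker X u : (u \in coord_ker X) = (flat_coord X u == 0).
Proof. by rewrite memv_annihilator /functional big_seq1 mul1r. Qed.

Lemma eliminateP y ys (x : Z) (v0 w : seq Z) u0 u :
  matches (y :: ys) (x :: v0) u0 -> matches (y :: ys) w u -> ~~ isZ0 x ->
  exists a b, [/\ a *: u + b *: u0 \in coord_ker y &
    matches ys (eliminate x v0 w) (a *: u + b *: u0)].
Proof.
case: w => [|b w] //; rewrite /matches /= !eqseq_cons => /andP[/eqP ex /eqP ev0].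
move=> /andP[/eqP eb /eqP ew] x0; case: ifP => [b0|/negbT b0].
  exists 1, 0; rewrite scale1r scale0r addr0 memv_coord_ker -eb toR_eq0 b0.
  by split=> //; rewrite ew.
set g := Z.gcd x b.
have g0 : g <> Z0 by move=> /Z.gcd_eq_0_l xe; rewrite xe in x0.
have [q1 e1] := Z.gcd_divide_l x b; have [q2 e2] := Z.gcd_divide_r x b.
have -> : Z.div x g = q1 by rewrite [in X in Z.div X _]e1 Z.div_mul.
have -> : Z.div b g = q2 by rewrite [in X in Z.div X _]e2 Z.div_mul.
exists (toR q1), (- toR q2); split.
  rewrite memv_coord_ker flat_coordD !flat_coordZ -ex -eb [in toR x]e1 [in toR b]e2.
  by rewrite !toRM mulNr subr_eq0 mulrCA.
rewrite -map_comp; apply/eqP.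
have {ev0} := ev0; have {ew} := ew.
elim: ys v0 w => [|y' ys IH] [|a v0] [|c w] //= [ec ew] [ea ev].
congr (_ :: _); last exact: IH.
by rewrite toRB !toRM flat_coordD !flat_coordZ ec ea mulNr.
Qed.

(** A step of the elimination replaces [U] by its intersection with the kernel
of a coordinate on which the first vector does not vanish, which lowers the
dimension. *)
Lemma independent_dim n rows vs ys U :
  independent n rows -> all2 (matches ys) rows vs -> {subset vs <= U} ->
  (size rows <= \dim U)%N.
Proof.
elim: n rows vs ys U => [|n IH] [|[|x v0] rows] //= [|u0 vs] //= ys U.
move=> /andP[x0 ind] /andP[m0 ms] vsU; case: ys m0 ms => [|y ys] m0 ms.
  by move: m0; rewrite /matches /=.
have [us [ms' usU]] : exists us, all2 (matches ys) [seq eliminate x v0 w | w <- rows] us /\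
    {subset us <= (U :&: coord_ker y)%VS}.
  have u0U : u0 \in U by apply: vsU; rewrite mem_head.
  have {vsU} vsU : {subset vs <= U} by move=> u uv; apply: vsU; rewrite inE uv orbT.
  elim: rows vs ms vsU {ind} => [|w rows IHr] [|u vs] //=; first by exists [::].
  case/andP=> mu ms vsU; have [us [ms' usU]] := IHr vs ms (fun z zv => vsU z (mem_behead (s := u :: vs) zv)).
  have [a [b [ker_ab m_ab]]] := eliminateP m0 mu x0.
  exists (a *: u + b *: u0 :: us); split; first by rewrite /= m_ab.
  move=> z; rewrite inE => /predU1P[->|/usU//]; rewrite memv_cap ker_ab andbT.
  by rewrite memvD ?memvZ // vsU ?mem_head.
have := IH _ us ys _ ind ms' usU; rewrite size_map => /leq_ltn_trans; apply.
have u0U : u0 \in U by apply: vsU; rewrite mem_head.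
rewrite (ltn_leqif (dimv_leqif_eq (capvSl U (coord_ker y)))).
apply/eqP => eU; move: u0U; rewrite -eU memv_cap memv_coord_ker => /andP[_].
by move: m0; rewrite /matches /= eqseq_cons => /andP[/eqP <- _]; rewrite toR_eq0 (negPf x0).
Qed.

(** * Upper bounds *)

Lemma free_flat_vec (P : seq (flat M)) : uniq P -> free [seq flat_vec R x | x <- P].
Proof.
elim: P => [|x P IH] /=; first by rewrite nil_free.
case/andP=> xP uP; rewrite free_cons IH // andbT; apply/negP => xin.
have: (<<[seq flat_vec R x | x <- P]>> <= annihilator M [:: (x : {set E}, 1 : R)])%VS.
  apply/span_subvP => _ /mapP[y yP ->].
  rewrite memv_annihilator /functional big_seq1 mul1r /flat_coord cl_flat ffunE.
  by case: (eqVneq x y) => [xy|_]; [rewrite xy yP in xP | rewrite mul0r].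
move=> /subvP/(_ _ xin); rewrite memv_annihilator /functional big_seq1 mul1r.
by rewrite /flat_coord cl_flat ffunE eqxx mul1r invr_eq0 (negPf (beta_neq0 R x)).
Qed.

(** A space of vectors supported on [L] that meets trivially the vectors
supported on [P] has codimension at least the size of [P].  Here [P] will be
the pivots of functionals in echelon form. *)
Lemma dim_layer_leq U (L P : seq (flat M)) :
  uniq P -> {subset P <= L} ->
  (forall u x, u \in U -> u x != 0 -> x \in L) ->
  (forall u, u \in U -> (forall x, x \notin P -> u x = 0) -> u = 0) ->
  (\dim U + size P <= size L)%N.
Proof.
move=> uP PL UL UP; set B := [seq flat_vec R x | x <- P].
have suppB u x : u \in <<B>>%VS -> x \notin P -> u x = 0.
  move=> uB xP; have: (<<B>> <= annihilator M [:: (x : {set E}, 1 : R)])%VS.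
    apply/span_subvP => _ /mapP[y yP ->].
    rewrite memv_annihilator /functional big_seq1 mul1r /flat_coord cl_flat ffunE.
    by case: (eqVneq x y) => [xy|_]; [rewrite xy yP in xP | rewrite mul0r].
  move=> /subvP/(_ _ uB); rewrite memv_annihilator /functional big_seq1 mul1r.
  by rewrite /flat_coord cl_flat mulf_eq0 invr_eq0 (negPf (beta_neq0 R x)) orbF => /eqP.
have UB0 : (U :&: <<B>> = 0)%VS.
  apply/eqP; rewrite -subv0; apply/subvP => u; rewrite memv_cap => /andP[uU uB].
  by rewrite memv0; apply/eqP/UP => // x; apply: suppB.
rewrite -(size_map (@flat_vec R E M) P) -/B (_ : size B = \dim <<B>>); last first.
  by apply/esym/eqP/free_flat_vec.
rewrite -dimv_disjoint_sum // -(size_map (@flat_vec R E M) L).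
apply: leq_trans (dim_span _); apply: dimvS; apply/subvP => u /memv_addP[u1 u1U [u2 u2B ->]].
have inL v : (forall x, v x != 0 -> x \in L) -> v \in <<[seq flat_vec R x | x <- L]>>%VS.
  move=> vL; rewrite (flat_spaceE v); apply: memv_suml => x _.
  have [->|/vL xL] := eqVneq (v x) 0; first by rewrite scale0r mem0v.
  by apply/memvZ/memv_span/map_f.
apply: memvD; apply: inL => x; first exact: UL.
by move=> ux; apply: PL; apply: contra_neqT ux => /suppB->.
Qed.

Lemma C_beta_rank k u x : (k <= r)%N -> u \in C_beta R M k -> u x != 0 ->
  (rk M x + k)%N = r.
Proof.
move=> le_k uC; apply: contraNeq => rx.
have: (C_beta R M k <= annihilator M [:: (x : {set E}, 1 : R)])%VS.
  apply: C_beta_min => // w sw; rewrite memv_annihilator functional_vec; last exact: closed_wf.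
  rewrite big_seq1 mul1r; apply: contraNT rx => /wf_rank; rewrite sw => ->.
  by [].
move=> /subvP/(_ _ uC); rewrite memv_annihilator /functional big_seq1 mul1r.
by rewrite /flat_coord cl_flat mulf_eq0 invr_eq0 (negPf (beta_neq0 R x)) orbF.
Qed.

Lemma h_beta1_leq : (0 < r)%N -> (h_beta R M 1 <= #|E|.+1)%N.
Proof.
move=> r0; rewrite /h_beta -card_option cardE -(size_map (fun o => vec M (wf R M [:: o]))).
apply: leq_trans (dim_span _); apply: dimvS; apply: C_beta_min => // -[|o [|]] // _.
by apply/memv_span/map_f; rewrite mem_enum.
Qed.

End Bounds.

(** * The commuting part is symmetric *)

Section Symmetry.
Local Open Scope ring_scope.
Variables (R : realFieldType) (E : finType) (M : matroid E).
Notation V := (flat_space R M).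
Notation r := (matroid_rank M).
Implicit Types (x y : flat M) (X Y : {set E}) (u v : V) (k : nat).

Lemma rk_basis Y : exists l : seq E, [/\ size l = rk M Y, [set a in l] \subset Y,
  rk M [set a in l] = rk M Y & forall X, rk M (X :|: [set a in l]) = rk M (X :|: Y)].
Proof.
have [I [Ii _ IY cI]] := rk_extend (indep0 M) (sub0set Y).
have eI : [set a in enum I] = I by apply/setP => a; rewrite inE mem_enum.
have rI : rk M I = rk M Y by rewrite -cI; apply/eqP; rewrite -rk_indep.
exists (enum I); rewrite eI -cardE; split=> // X.
apply/eqP; rewrite eqn_leq rk_mono ?setUS //= -[X in (_ <= X)%N]rk_clU rk_mono // setUS //.
apply/subsetP => a aY; rewrite inE eqn_leq [X in _ && X]rk_mono ?subsetUr // andbT rI.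
by apply: rk_mono; rewrite subUset sub1set aY.
Qed.

Lemma rk_setU_leq X Y : (rk M (X :|: Y) <= rk M X + rk M Y)%N.
Proof.
have [l [sl _ _ <-]] := rk_basis Y; rewrite -sl => {sl}.
elim: l => [|a l IH]; first by rewrite set_nil setU0 addn0.
by rewrite set_cons setUCA /= addnS (leq_trans (rk_setU1_leq _ _ _)) ?ltnS.
Qed.

(** The flats [y] of rank [k] and the sets [X] of rank [r - k] that together
span. *)
Definition pairing k y X : bool :=
  [&& rk M y == k, rk M X + k == r & rk M (X :|: y) == r]%N.

Definition flat_word k y : V := vec M (fun X => (pairing k y X)%:R).

(** A word without average depends only on the closure of its letters, and it
vanishes unless these are independent. *)
Lemma C_zeroE k :
  C_zero R M k = <<[seq flat_word k y | y : flat M]>>%VS.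
Proof.
apply/eqP; rewrite eqEsubv; apply/andP; split.
  apply: C_zero_min => l sl; have [rl|rl] := eqVneq (rk M [set a in l]) k.
    rewrite (_ : vec M _ = flat_word k (cl M [set a in l])).
      by apply/memv_span/image_f.
    apply/ffunP => x; rewrite !ffunE wf_lword /pairing sl rk_cl rl eqxx /=.
    by rewrite rk_clU.
  rewrite (_ : vec M _ = 0) ?mem0v //; apply/ffunP => x; rewrite !ffunE wf_lword.
  case: andP => [[/eqP rx /eqP rxl]|_]; last by rewrite mulr0.
  case/negP: rl; have := rk_setU_leq x [set a in l]; rewrite rxl -rx sl.
  have rk_l : (rk M [set a in l] <= size l)%N.
    by apply: leq_trans (rk_leq_card M _) _; rewrite cardsE; apply: card_size.
  by rewrite leq_add2l eqn_leq -[X in (_ <= X)%N && _]sl rk_l.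
apply/span_subvP => _ /imageP[y _ ->]; have [ry|ry] := eqVneq (rk M y) k; last first.
  rewrite (_ : flat_word k y = 0) ?mem0v //; apply/ffunP => x.
  by rewrite !ffunE /pairing (negPf ry) mulr0.
have [l [sl _ _ rl]] := rk_basis y.
rewrite (_ : flat_word k y = vec M (wf R M (lword l))).
  by rewrite -ry -sl; apply: C_zero_mem.
by apply/ffunP => x; rewrite !ffunE wf_lword /pairing ry eqxx rl sl ry.
Qed.

Lemma h_zero_leq k : (h_zero R M k <= #|[pred y : flat M | rk M y == k]|)%N.
Proof.
rewrite /h_zero C_zeroE cardE.
set L := enum _; rewrite -(size_map (flat_word k) L).
apply: leq_trans (dim_span _); apply: dimvS; apply/span_subvP => _ /imageP[y _ ->].
have [ry|ry] := eqVneq (rk M y) k; last first.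
  rewrite (_ : flat_word k y = 0) ?mem0v //; apply/ffunP => x.
  by rewrite !ffunE /pairing (negPf ry) mulr0.
by apply/memv_span/map_f; rewrite mem_enum inE ry.
Qed.

Import VectorInternalTheory.

Definition pairing_mx k : 'M[R]_#|@predT (flat M)| :=
  \matrix_(i, j) (pairing k (enum_val i) (enum_val j : flat M))%:R.

(** Dividing the coordinates by the nonzero numbers [beta] does not change the
rank of the family [flat_word k]. *)
Lemma h_zero_rank k : h_zero R M k = \rank (pairing_mx k).
Proof.
rewrite /h_zero C_zeroE.
pose B := \matrix_(j < #|@predT (flat M)|)
  v2r (beta R (enum_val j : flat M) *: flat_vec R (enum_val j) : V).
have Bfree : row_free B.
  apply: inj_row_free => c cB0.
  have s0 : \sum_j c 0 j *: (beta R (enum_val j : flat M) *: flat_vec R (enum_val j) : V) = 0.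
    apply: (can_inj v2rK); rewrite linear0 -cB0 mulmx_sum_row linear_sum.
    by apply: eq_bigr => j _; rewrite rowK linearZ.
  apply/rowP => j; rewrite mxE; have /ffunP/(_ (enum_val j)) := s0.
  rewrite sum_ffunE (bigD1 j) //= big1 => [|i ij].
    rewrite !ffunE eqxx addr0 -![_ *: _]/(_ * _) mulr1 => /eqP.
    by rewrite mulf_eq0 (negPf (beta_neq0 R _)) orbF => /eqP.
  rewrite !ffunE (inj_eq enum_val_inj) eq_sym (negPf ij).
  by rewrite -![_ *: _]/(_ * _) !mulr0.
rewrite -(mxrankMfree _ Bfree).
have -> : pairing_mx k *m B = \matrix_i v2r (flat_word k (enum_val i)).
  apply/row_matrixP => i; rewrite row_mul mulmx_sum_row rowK.
  have -> : flat_word k (enum_val i) = \sum_j pairing_mx k i j *: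
      (beta R (enum_val j : flat M) *: flat_vec R (enum_val j) : V).
    apply/ffunP => x; rewrite sum_ffunE (bigD1 (enum_rank_in (isT : x \in predT) x)) //=.
    rewrite big1 => [|j jx]; rewrite !ffunE.
      by rewrite enum_rankK_in // eqxx !mxE enum_rankK_in // addr0 -![_ *: _]/(_ * _) mulr1 mulrC.
    case: (eqVneq x (enum_val j)) => [xj|_]; last by rewrite -![_ *: _]/(_ * _) !mulr0.
    by case/eqP: jx; rewrite xj enum_valK_in.
  rewrite linear_sum; apply: eq_bigr => j _.
  by rewrite rowK [row i _ 0 j]mxE; apply/esym/linearZ.
pose X := [tuple flat_word k (enum_val i) | i < #|@predT (flat M)|].
rewrite (_ : <<_>>%VS = <<X>>%VS); last first.
  apply/eqP; rewrite eqEsubv; apply/andP; split; apply/span_subvP => u.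
    case/imageP=> y _ ->; apply/memv_span/tnthP.
    exists (enum_rank_in (isT : y \in predT) y).
    by rewrite tnth_mktuple enum_rankK_in.
  by case/tnthP=> i ->; rewrite tnth_mktuple; apply/memv_span/image_f.
have -> : <<X>>%VS = mx2vs (b2mx X).
  by rewrite unlock tvalK; case: _ / (esym _).
rewrite /dimv genmxE; congr mxrank; apply/row_matrixP => i.
by rewrite !rowK tnth_mktuple.
Qed.

Lemma h_zero_sym k : (k <= r)%N -> h_zero R M (r - k) = h_zero R M k.
Proof.
move=> le_k; rewrite !h_zero_rank -mxrank_tr; congr mxrank.
apply/matrixP => i j; rewrite !mxE /pairing setUC; congr (_%:R); congr nat_of_bool.
by apply/and3P/and3P => -[/eqP e1 /eqP e2 e3]; split=> //; apply/eqP; lia.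
Qed.

End Symmetry.

(** * Evaluating words on a tree *)

Notation mask := (seq bool).
Notation word := (seq (option nat)).

Definition raises (t : tree nat) (m : mask) : seq mask :=
  let k := look t m in
  [seq m' <- [seq setb m i | i <- iota 0 8] | Nat.ltb k (look t m')].

Fixpoint sumZ (s : seq Z) : Z := if s is x :: s' then Z.add x (sumZ s') else Z0.

(** [840 / k], an integer for [k <= 8]. *)
Definition share (k : nat) : Z :=
  nth Z0 (Z0 :: map Zpos [:: 840; 420; 280; 210; 168; 140; 120; 105]%positive) k.

Fixpoint value (t : tree nat) (r : nat) (w : word) (m : mask) : Z :=
  match w with
  | [::] => if eqn (look t m) r then Zpos xH else Z0
  | Some i :: w' =>
    let m' := setb m i in
    if Nat.ltb (look t m) (look t m') then value t r w' m' else Z0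
  | None :: w' =>
    let ms := raises t m in
    Z.mul (share (size ms)) (sumZ [seq value t r w' m' | m' <- ms])
  end.

Definition letters (w : word) : bool :=
  all (fun o => if o is Some i then i < 8 else true) w.

Definition averages (w : word) : nat := count (pred1 None) w.

Section Evaluation.
Variables (R : realFieldType) (E : finType) (M : matroid E).
Variables (s : seq E) (t : tree nat).
Hypotheses (us : uniq s) (ms : forall x, x \in s) (ss : size s = 8).
Hypothesis tE : forall A, ev s t A = rk M A.
Notation r := (matroid_rank M).
Implicit Types (m : mask) (w : word).

Variable e0 : E.

Local Open Scope ring_scope.

Definition el (i : nat) : E := nth e0 s i.

Definition letter_word w : seq (option E) := map (omap el) w.

Lemma look_rk m : size m = 8 -> look t m = rk M (setof s m).
Proof. by move=> sm; rewrite -tE (look_setof t us) ?ss. Qed.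

Lemma setof_el m i : size m = 8 -> (i < 8)%N -> setof s (setb m i) = el i |: setof s m.
Proof. by move=> sm lti; apply: setof_setb; rewrite ?ss. Qed.

Lemma sumZE (l : seq Z) : toR R (sumZ l) = \sum_(x <- l) toR R x.
Proof. by elim: l => [|x l IH]; rewrite ?big_nil // big_cons toRD IH. Qed.

Lemma el_onto a : exists2 i, (i < 8)%N & a = el i.
Proof. by exists (index a s); rewrite ?/el ?nth_index // -ss index_mem. Qed.

Lemma big_raises m (F : {set E} -> R) : size m = 8 ->
  \sum_(m' <- raises t m) F (setof s m') =
  \sum_(a in raising M (setof s m)) F (a |: setof s m).
Proof.
move=> sm; rewrite /raises big_filter big_map.
rewrite [RHS](_ : _ = \sum_(a <- s | a \in raising M (setof s m)) F (a |: setof s m)).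
  rewrite (big_nth e0) ss /index_iota subn0.
  rewrite [LHS]big_seq_cond [RHS]big_seq_cond; apply: eq_big => i.
    case: (boolP (i \in _)) => //; rewrite mem_iota add0n => lti; rewrite !andTb.
    by rewrite ltbE !look_rk ?size_setb // setof_el // inE.
  by rewrite mem_iota add0n => /andP[lti _]; rewrite setof_el.
have pe : perm_eq s (enum E).
  by apply: uniq_perm us (enum_uniq _) _ => a; rewrite ms mem_enum.
by rewrite (perm_big _ pe) big_enum_cond.
Qed.

Lemma raises_size m m' : size m = 8 -> m' \in raises t m -> size m' = 8.
Proof.
by move=> sm; rewrite mem_filter => /andP[_ /mapP[i _ ->]]; rewrite size_setb.
Qed.

Lemma size_raises m : size m = 8 -> size (raises t m) = #|raising M (setof s m)|.
Proof.
move=> sm; have := big_raises (fun _ => 1) sm.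
rewrite big_const_seq count_predT iter_addr_0 sumr_const => /eqP.
by rewrite eqr_nat => /eqP.
Qed.

Lemma share_mul k : (0 < k <= 8)%N -> toR R (share k) * k%:R = 840%:R.
Proof.
rewrite /toR -[k%:R]/(k%:Z%:~R) -[840%:R]/(840%:Z%:~R) -intrM.
case/andP=> k0 k8; congr (_%:~R).
by move: k k0 k8; do 9![case=> //].
Qed.

(** Every average contributes a factor 840, by which the division by the number
of raising elements becomes exact. *)
Lemma value_wf w m : letters w -> size m = 8 ->
  toR R (value t r w m) = 840%:R ^+ averages w * wf R M (letter_word w) (setof s m).
Proof.
elim: w m => [|[i|] w IH] m /=.
- move=> _ sm; rewrite look_rk // expr0 mul1r eqnE.
  by case: eqP => _; rewrite /toR.
- move=> /andP[lti lw] sm; rewrite add0n /step ltbE !look_rk ?size_setb //.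
  rewrite setof_el //; case: ifP => gi; last by rewrite mulr0 /toR.
  by rewrite IH ?size_setb // setof_el.
move=> lw sm; rewrite toRM sumZE big_map /averages /= exprS.
rewrite big_seq_cond (eq_bigr (fun m' => 840%:R ^+ averages w *
  wf R M (letter_word w) (setof s m'))); last first.
  by move=> m' /andP[m'in _]; apply: IH => //; apply: raises_size m'in.
rewrite -big_seq_cond -mulr_sumr big_raises // /avg sum_step size_raises //.
set S := \sum_(_ in _) _; set k := #|_|.
have [k0|k0] := posnP k; first by rewrite k0 invr0 !mulr0 /toR mul0r.
have kn0 : k%:R != 0 :> R by rewrite pnatr_eq0 -lt0n.
rewrite mulrCA [840%:R * _]mulrC -[RHS]mulrA; congr (_ * _).
apply: (mulIf kn0); rewrite mulrAC share_mul; last first.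
  by rewrite k0 -ss -(card_uniqP us) subset_leq_card //; apply/subsetP.
by rewrite -mulrA divfK.
Qed.

End Evaluation.

(** * Certificates *)

Notation dual := (seq (mask * Z)).
Notation relation := (seq (word * Z)).

Definition full_mask : mask := nseq 8 true.
Definition empty_mask : mask := nseq 8 false.
Definition mask_of (T : seq nat) : mask := foldl setb empty_mask T.
Definition lword_of (T : seq nat) : word := map Some T.

Definition flat_mask (t : tree nat) (m : mask) : bool :=
  let k := look t m in
  all (fun i => if nth false m i then true else Nat.ltb k (look t (setb m i)))
      (iota 0 8).

Fixpoint all_masks n : seq mask :=
  if n is n'.+1 then
    let l := all_masks n' in map (cons false) l ++ map (cons true) l
  else [:: [::]].

Definition flat_masks (t : tree nat) : seq mask := filter (flat_mask t) (all_masks 8).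

Definition layer (t : tree nat) (fl : seq mask) (j : nat) : seq mask :=
  [seq m <- fl | eqn (look t m) j].

(** Certificate of a lower bound: words of length [k] that are independent by
their values on the chosen flats. *)
Definition lower_ok (t : tree nat) (r k : nat) (c : seq word * seq mask) : bool :=
  all (fun w => letters w && (size w == k)) c.1 && all (fun m => size m == 8) c.2
  && independent (size c.1) [seq [seq value t r w m | m <- c.2] | w <- c.1].

Fixpoint words (al : seq (option nat)) k : seq word :=
  if k is k'.+1 then flatten [seq [seq o :: w | w <- words al k'] | o <- al]
  else [:: [::]].

Definition atoms : seq (option nat) := map Some (iota 0 8).

Definition apply_dual t r (z : dual) (w : word) : Z :=
  sumZ [seq Z.mul p.2 (value t r w p.1) | p <- z].

Definition kills t r al k (z : dual) : bool :=
  all (fun w => isZ0 (apply_dual t r z w)) (words al k).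

Definition pivot (z : dual) : mask := if z is (m, _) :: _ then m else [::].

(** The functionals [zs] are in echelon form, each having a pivot that occurs in
no tail, and each kills all words of length [k]. *)
Definition upper_ok t r (fl : seq mask) k (zs : seq dual) : bool :=
  let ps := map pivot zs in
  uniq ps && all (fun z =>
    if z is (m, c) :: z' then
      [&& ~~ isZ0 c, eqn (look t m) (r - k), all (fun p => p.1 \in fl) z,
          all (fun p => p.1 \notin ps) z' & kills t r (None :: atoms) k z]
    else false) zs.

Definition apply_relation t r (c : relation) (m : mask) : Z :=
  sumZ [seq Z.mul p.2 (value t r p.1 m) | p <- c].

(** A combination of the average of one word without average and of longer words
without average, which vanishes on the flats [ms]; the head of the combination
is the average. *)
Definition entry_ok t r k (ms : seq mask) (e : seq nat * relation) : bool :=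
  if e is (T, (w, x) :: c) then
    [&& w == None :: lword_of T, all (fun i => i < 8) T, size T == k, ~~ isZ0 x,
        all (fun p => [&& all isSome p.1, letters p.1 & size p.1 == k.+1]) c &
        all (fun m => isZ0 (apply_relation t r e.2 m)) ms]
  else false.

(** The flat [m] of rank [k] is spanned by [T]: both [T] and its union with [m]
have rank [k]. *)
Definition same_closure t k (m : mask) (T : seq nat) : bool :=
  eqn (look t (mask_of T)) k && eqn (look t (foldl setb m T)) k.

(** If the number of raising elements is constant on a layer, then the average
is there a multiple of the sum of the letters, and no relation is needed.
Otherwise there is one relation for the closure of each independent word. *)
Definition layer_closed t r fl k (es : seq (seq nat * relation)) : bool :=
  let ms := layer t fl (r - k.+1) in
  constant [seq size (raises t m) | m <- ms] ||
  all (entry_ok t r k ms) es &&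
  all (fun m => has (fun e => same_closure t k m e.1) es) (layer t fl k).

Definition averages_commute t r fl (ess : seq (seq (seq nat * relation))) : bool :=
  all (fun k => layer_closed t r fl k (nth [::] ess k)) (iota 0 r).

(** The functional [z] kills all words without average of length
[(size T).+1], but not the average of the word [T]. *)
Definition averages_escape t r (T : seq nat) (z : dual) : bool :=
  [&& all (fun i => i < 8) T, size T < r, all (fun p => size p.1 == 8) z,
      kills t r atoms (size T).+1 z &
      ~~ isZ0 (apply_dual t r z (None :: lword_of T))].

(** [verdict] proves [H_beta] and [H_zero] equal on the left and different on the
right. *)
Record cert := Cert {
  lowers : seq (seq word * seq mask);
  duals : seq dual;
  verdict : seq (seq (seq nat * relation)) + seq nat * dual
}.

Definition escapes (c : cert) : bool := if verdict c is inr _ then true else false.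

Definition low (c : cert) k : nat := size (nth ([::], [::]) (lowers c) k).1.

(** Functionals are provided in length [r - 2] only, where the number of flats
alone is sometimes too large a bound for log-concavity.  When [C_beta] and
[C_zero] agree, [h_zero_leq] gives one bound more.  The 9 is the number of words
of length one. *)
Definition up t r fl (c : cert) k : nat :=
  let u := size (layer t fl (r - k)) - (if k == r - 2 then size (duals c) else 0) in
  let u := if k == 1 then minn u 9 else u in
  if escapes c then u else minn u (size (layer t fl k)).

(** When the verdict is equality, the symmetry needs no comparison of bounds: it
is [h_zero_sym]. *)
Definition cert_ok (t : tree nat) (c : cert) : bool :=
  let r := look t full_mask in
  let fl := flat_masks t in
  [&& 1 < r, all (fun k => lower_ok t r k (nth ([::], [::]) (lowers c) k)) (iota 0 r),
      upper_ok t r fl (r - 2) (duals c),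
      match verdict c with
      | inl ess => averages_commute t r fl ess
      | inr (T, z) => averages_escape t r T z
      end,
      all (fun k => up t r fl c k.-1 * up t r fl c k.+1 < low c k * low c k)
          (iota 1 (r - 1)) &
      escapes c ==> all (fun k => (k < r - k) ==> (up t r fl c (r - k) <= low c k))
                        (iota 0 r)].

(** * Soundness of the certificates *)

Lemma mem_all_masks n m : (m \in all_masks n) = (size m == n).
Proof.
elim: n m => [|n IH] [|b m] //=; first by apply/negbTE; rewrite mem_cat;
  apply/negP => /orP[] /mapP[? _].
rewrite eqSS -IH mem_cat; apply/orP/idP => [|mn].
  by case=> /mapP[m' m'n [_ ->]].
by case: b; [right | left]; apply: map_f.
Qed.

Lemma all_masks_uniq n : uniq (all_masks n).
Proof.
elim: n => //= n IH; rewrite cat_uniq !map_inj_uniq ?IH //=; try by move=> ? ? [].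
by rewrite andbT; apply/hasPn => _ /mapP[m _ ->]; apply/mapP => -[].
Qed.

Lemma mem_words al k w : size w = k -> {subset w <= al} -> w \in words al k.
Proof.
elim: k w => [|k IH] [|o w] //= [sw] wal; apply/flatten_mapP; exists o.
  by apply: wal; rewrite mem_head.
by apply/map_f/IH => // x xw; apply: wal; rewrite inE xw orbT.
Qed.

Section Soundness.
Variables (R : realFieldType) (E : finType) (M : matroid E).
Variables (s : seq E) (t : tree nat) (e0 : E).
Hypotheses (us : uniq s) (ms : forall x, x \in s) (ss : size s = 8).
Hypothesis tE : forall A, ev s t A = rk M A.
Notation r := (matroid_rank M).
Notation fl := (flat_masks t).
Notation V := (flat_space R M).
Implicit Types (m : mask) (w : word) (k : nat).
Notation el := (el s e0).
Notation letter_word := (letter_word s e0).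
Local Open Scope ring_scope.

Let look_rk m : size m = 8 -> look t m = rk M (setof s m) := look_rk us ss tE (m := m).
Let setof_el := setof_el us ss e0.
Let value_wf := @value_wf R E M s t us ms ss tE e0.
Let el_onto := el_onto ms ss e0.
Let size_raises := @size_raises R E M s t us ms ss tE e0.

Definition el_flat m : flat M := cl M (setof s m).

Lemma mem_setof m i : size m = 8 -> (i < 8)%N -> (el i \in setof s m) = nth false m i.
Proof.
move=> sm lti; rewrite -[in RHS](setofK us (etrans sm (esym ss))).
by rewrite (nth_map e0) ?ss.
Qed.

Lemma setof_inj m m' : size m = 8 -> size m' = 8 -> setof s m = setof s m' -> m = m'.
Proof.
move=> sm sm' e; rewrite -(setofK us (etrans sm (esym ss))) e.
by rewrite (setofK us (etrans sm' (esym ss))).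
Qed.

Lemma setof_full : setof s full_mask = setT.
Proof.
apply/setP => a; have [i lti ->] := el_onto a.
by rewrite mem_setof ?size_nseq // nth_nseq lti inE.
Qed.

Lemma look_full : look t full_mask = r.
Proof. by rewrite look_rk ?size_nseq // setof_full. Qed.

Lemma flat_mask_size m : m \in fl -> size m = 8.
Proof. by rewrite mem_filter mem_all_masks => /andP[_ /eqP]. Qed.

Lemma flat_maskP m : m \in fl -> el_flat m = setof s m :> {set E}.
Proof.
move=> mfl; have sm := flat_mask_size mfl.
move: mfl; rewrite mem_filter => /andP[/allP fm _].
apply/eqP; rewrite eqEsubset sub_closure andbT; apply/subsetP => a.
have [i lti ->] := el_onto a; rewrite inE => /eqP gi.
have := fm i; rewrite mem_iota lti => /(_ isT).
rewrite ltbE !look_rk ?size_setb // setof_el // gi ltnn mem_setof //.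
by case: nth.
Qed.

Lemma mem_flat_masks (x : flat M) : ind s x \in fl.
Proof.
have si : size (ind s x) = 8 by rewrite size_ind.
have sx : setof s (ind s x) = x by apply: indK; apply/subsetP => a _; apply: ms.
rewrite mem_filter mem_all_masks si eqxx andbT; apply/allP => i.
rewrite mem_iota add0n => lti; rewrite ltbE !look_rk ?size_setb // setof_el // sx.
by rewrite raising_flat (nth_map e0) ?ss // -/(el i); case: (_ \in _).
Qed.

Lemma el_flat_ind (x : flat M) : el_flat (ind s x) = x.
Proof.
rewrite /el_flat indK ?cl_flat //; apply/subsetP => a _; exact: ms.
Qed.

Lemma rk_el_flat m : size m = 8 -> rk M (el_flat m) = look t m.
Proof. by move=> sm; rewrite rk_cl look_rk. Qed.

Lemma mem_layer j m : (m \in layer t fl j) = (m \in fl) && (rk M (el_flat m) == j).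
Proof.
rewrite mem_filter andbC; case: (boolP (m \in fl)) => //= /flat_mask_size sm.
by rewrite rk_el_flat.
Qed.

Lemma mem_layer_ind j (x : flat M) : (ind s x \in layer t fl j) = (rk M x == j).
Proof. by rewrite mem_layer mem_flat_masks el_flat_ind. Qed.

Lemma card_layer j : #|[pred x : flat M | rk M x == j]| = size (layer t fl j).
Proof.
have inj : {in layer t fl j &, injective el_flat}.
  move=> m m'; rewrite !mem_layer => /andP[mf _] /andP[mf' _] e.
  apply: setof_inj; try exact: flat_mask_size.
  by rewrite -(flat_maskP mf) -(flat_maskP mf') e.
rewrite -(size_map el_flat) -(card_uniqP _); last first.
  by rewrite map_inj_in_uniq // !filter_uniq // all_masks_uniq.
apply: eq_card => x; rewrite inE; apply/eqP/mapP => [rx|[m]].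
  by exists (ind s x); rewrite ?el_flat_ind // mem_layer_ind rx.
by rewrite mem_layer => /andP[_ /eqP <-] ->.
Qed.

Lemma wordE (v : seq (option E)) : exists2 w, v = letter_word w &
  letters w /\ {subset w <= None :: atoms}.
Proof.
elim: v => [|[a|] v [w -> [lw wal]]]; first by exists [::].
  have [i lti ->] := el_onto a; exists (Some i :: w) => //.
  split=> [|o]; first by rewrite /= lti.
  rewrite inE => /predU1P[->|/wal//]; rewrite inE; apply/orP; right.
  by apply: map_f; rewrite mem_iota.
exists (None :: w) => //; split=> // o; rewrite inE => /predU1P[->|/wal//].
exact: mem_head.
Qed.

Lemma lwordE (l : seq E) : exists2 T, l = map el T & all (fun i => i < 8)%N T.
Proof.
elim: l => [|a l [T -> lT]]; first by exists [::].
by have [i lti ->] := el_onto a; exists (i :: T); rewrite //= lti.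
Qed.

Lemma letter_lword T : letter_word (lword_of T) = lword (map el T).
Proof. by rewrite /letter_word /lword_of /lword -!map_comp. Qed.

Lemma letters_lword T : letters (lword_of T) = all (fun i => i < 8)%N T.
Proof. by rewrite /letters all_map. Qed.

Lemma size_letter_word w : size (letter_word w) = size w.
Proof. exact: size_map. Qed.

Let c840 : (840%:R : R) != 0. Proof. by rewrite pnatr_eq0. Qed.

Lemma lower_okP k c : (k <= r)%N -> lower_ok t r k c -> (size c.1 <= h_beta R M k)%N.
Proof.
move=> le_k /andP[/andP[/allP wk /allP m8] ind].
pose vs := [seq 840%:R ^+ averages w *: vec M (wf R M (letter_word w)) | w <- c.1] : seq V.
rewrite -(size_map (fun w => [seq value t r w m | m <- c.2])).
apply: (independent_dim (vs := vs) (ys := [seq el_flat m | m <- c.2]) ind).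
  rewrite /vs; elim: c.1 wk {ind vs} => [//|w ws IH] wk /=.
  rewrite IH ?andbT => [|w' w'in]; last by apply: wk; rewrite inE w'in orbT.
  have /andP[lw _] := wk w (mem_head _ _).
  rewrite /matches -!map_comp; apply/eqP/eq_in_map => m /m8 /eqP sm /=.
  rewrite flat_coordZ flat_coord_vec; last exact: closed_wf.
  by rewrite value_wf // closed_wf.
move=> _ /mapP[w /wk /andP[_ /eqP sw] ->]; apply: memvZ.
by rewrite -sw -size_letter_word; apply: C_beta_mem; rewrite size_letter_word sw.
Qed.

Definition real_dual (z : dual) : seq ({set E} * R) :=
  [seq (setof s p.1, toR R p.2) | p <- z].

Lemma apply_dualE (z : dual) w : letters w -> all (fun p => size p.1 == 8%N) z ->
  toR R (apply_dual t r z w) =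
  840%:R ^+ averages w * functional (real_dual z) (vec M (wf R M (letter_word w))).
Proof.
move=> lw /allP z8; rewrite functional_vec; last exact: closed_wf.
rewrite /apply_dual sumZE !big_map mulr_sumr big_seq [RHS]big_seq.
apply: eq_bigr => p /z8 /eqP p8; rewrite toRM value_wf //=.
by rewrite mulrCA.
Qed.

Lemma killsP (z : dual) w k al : letters w -> size w = k -> {subset w <= al} ->
  all (fun p => size p.1 == 8%N) z -> kills t r al k z ->
  vec M (wf R M (letter_word w)) \in annihilator M (real_dual z).
Proof.
move=> lw sw wal z8 /allP/(_ w (mem_words sw wal)); rewrite -(toR_eq0 R) apply_dualE //.
by rewrite mulf_eq0 expf_eq0 (negPf c840) andbF memv_annihilator.
Qed.

(** A vector of [C_beta R M k] that vanishes outside the pivots vanishes at each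
pivot as well, by the functional that has it. *)
Lemma upper_okP k zs : (k <= r)%N -> upper_ok t r fl k zs ->
  (h_beta R M k <= size (layer t fl (r - k)) - size zs)%N.
Proof.
move=> le_k /andP[ups /allP zsP]; pose P := [seq el_flat (pivot z) | z <- zs].
have zP z : z \in zs -> exists m c z', [/\ z = (m, c) :: z', isZ0 c = false,
    m \in layer t fl (r - k), {subset map fst z <= fl} &
    {in z', forall p, p.1 \notin map pivot zs} /\ kills t r (None :: atoms) k z].
  case: z => [/zsP//|[m c] z'] /zsP /and5P[/negPf c0 /eqnP lm /allP zf /allP zn zk].
  exists m, c, z'; split=> //.
    by rewrite mem_filter lm eqnE eqxx; apply: (zf (m, c)); apply: mem_head.
  by move=> _ /mapP[p /zf pf ->].
have pf z : z \in zs -> pivot z \in layer t fl (r - k).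
  by move=> /zP[m [c [z' [-> _ ? _ _]]]].
have uP : uniq P.
  rewrite /P (map_comp el_flat pivot) map_inj_in_uniq // => m m'.
  move=> /mapP[z /pf zm ->] /mapP[z' /pf zm' ->] e.
  move: zm zm'; rewrite !mem_layer => /andP[zm _] /andP[zm' _].
  apply: setof_inj; try exact: flat_mask_size.
  by rewrite -(flat_maskP zm) -(flat_maskP zm') e.
rewrite leq_subRL; last first.
  rewrite -(size_map (el_flat \o pivot)) -(size_map el_flat (layer _ _ _)).
  by apply: uniq_leq_size uP _ => _ /mapP[z /pf zm ->]; apply: map_f.
rewrite addnC -(size_map (el_flat \o pivot) zs) -(size_map el_flat (layer _ _ _)).
apply: dim_layer_leq uP _ _ _.
- by move=> _ /mapP[z /pf zm ->]; apply: map_f.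
- move=> u x uC ux; have rx := C_beta_rank le_k uC ux.
  rewrite -(el_flat_ind x); apply: map_f; rewrite mem_layer_ind; apply/eqP; lia.
move=> u uC u0; apply/ffunP => x; rewrite ffunE.
have [/mapP[z z_in ->]|/u0//] := boolP (x \in P).
have [m [c [z' [ez c0 _ zf [zn zk]]]]] := zP z z_in.
have z8 : all (fun p => size p.1 == 8%N) z.
  by apply/allP => p pz; apply/eqP/flat_mask_size/zf/map_f.
have: u \in annihilator M (real_dual z).
  apply: (subvP (C_beta_min le_k _)) uC => v sv.
  have [w ev [lw wal]] := wordE v; rewrite ev.
  by apply: killsP z8 zk => //; rewrite -sv ev size_letter_word.
rewrite memv_annihilator /functional big_map ez big_cons /= big_seq big1 ?addr0.
  rewrite mulf_eq0 toR_eq0 c0 /= /flat_coord mulf_eq0 invr_eq0.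
  by rewrite (negPf (beta_neq0 R _)) orbF => /eqP.
move=> p pz'; rewrite /flat_coord u0 ?mul0r ?mulr0 //.
apply: contra (zn p pz') => /mapP[z1 z1_in e].
have p_fl : p.1 \in fl by apply: zf; rewrite ez; apply: map_f; rewrite inE pz' orbT.
have := pf _ z1_in; rewrite mem_layer => /andP[z1_fl _].
rewrite (_ : p.1 = pivot z1) ?map_f //.
apply: setof_inj; try exact: flat_mask_size.
by rewrite -(flat_maskP p_fl) -(flat_maskP z1_fl) -e.
Qed.

Lemma averages_escapeP T z : averages_escape t r T z ->
  (size T < r)%N /\ (h_zero R M (size T).+1 < h_beta R M (size T).+1)%N.
Proof.
case/and5P=> lT ltT z8 zk z0; split=> //.
rewrite /h_zero /h_beta (ltn_leqif (dimv_leqif_eq (C_zero_sub R ltT))).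
apply: contra z0 => /eqP eC; rewrite -(toR_eq0 R) apply_dualE //; last first.
  by rewrite /= letters_lword.
rewrite mulf_eq0; apply/orP; right; rewrite -memv_annihilator.
have le : (C_zero R M (size T).+1 <= annihilator M (real_dual z))%VS.
  apply: C_zero_min => l sl; have [T' el' lT'] := lwordE l.
  rewrite el' -letter_lword; apply: killsP z8 zk; rewrite ?letters_lword //.
    by rewrite -sl el' !size_map.
  move=> _ /mapP[i iT' ->]; apply: map_f; rewrite mem_iota.
  exact: (allP lT').
apply: (subvP le); rewrite eC; have := @C_beta_mem R E M (letter_word (None :: lword_of T)).
by rewrite size_letter_word /= size_map; apply.
Qed.

Lemma relationP (c : relation) k : (k < r)%N ->
  all (fun p => letters p.1 && (size p.1 == k.+1)) c ->
  all (fun m => isZ0 (apply_relation t r c m)) (layer t fl (r - k.+1)) ->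
  \sum_(p <- c) (toR R p.2 * 840%:R ^+ averages p.1) *:
    vec M (wf R M (letter_word p.1)) = 0.
Proof.
move=> ltk /allP cP /allP c0; apply/ffunP => x; rewrite sum_ffunE ffunE.
have [rx|rx] := eqVneq (rk M x) (r - k.+1)%N; last first.
  rewrite big_seq big1 // => p /cP /andP[_ /eqP sp]; rewrite !ffunE.
  rewrite [wf R M _ _](_ : _ = 0) ?mulr0 ?scaler0 //; apply: contra_neq_eq rx => /wf_rank.
  by rewrite size_letter_word sp; lia.
have := c0 (ind s x); rewrite mem_layer_ind rx eqxx => /(_ isT).
rewrite -(toR_eq0 R) /apply_relation sumZE !big_map => /eqP eq0.
rewrite -[RHS](mulr0 (beta R x)) -[in RHS]eq0 mulr_sumr big_seq [RHS]big_seq.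
apply: eq_bigr => p /cP /andP[lp _]; rewrite !ffunE toRM value_wf ?size_ind //.
rewrite indK; last by apply/subsetP => a _; apply: ms.
by rewrite -[_ *: _]/(_ * _) -!mulrA [RHS]mulrCA; congr (_ * _); rewrite mulrCA.
Qed.

Lemma setof_foldl m T : size m = 8%N -> all (fun i => i < 8)%N T ->
  setof s (foldl setb m T) = setof s m :|: [set a in map el T].
Proof.
elim: T m => [|i T IH] m sm /=; first by rewrite set_nil setU0.
by case/andP=> lti lT; rewrite IH ?size_setb // setof_el // set_cons setUCA setUA.
Qed.

Lemma size_foldl m T : size (foldl setb m T) = size m.
Proof. by elim: T m => //= i T IH m; rewrite IH size_setb. Qed.

Lemma setof_empty : setof s empty_mask = set0.
Proof.
apply/setP => a; have [i lti ->] := el_onto a.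
by rewrite mem_setof ?size_nseq // nth_nseq lti inE.
Qed.

Lemma cl_rk_eq (A B : {set E}) : A \subset B -> rk M A = rk M B -> cl M A = cl M B.
Proof.
move=> AB rAB; apply/val_inj/eqP; rewrite eqEsubset /= closure_mono //=.
rewrite closure_sub ?closure_flat //; apply/subsetP => a aB.
rewrite inE eqn_leq [X in _ && X]rk_mono ?subsetUr // andbT rAB.
by apply: rk_mono; rewrite subUset sub1set aB.
Qed.

Lemma same_closureP (x : flat M) k T : all (fun i => i < 8)%N T -> rk M x = k ->
  same_closure t k (ind s x) T -> cl M [set a in map el T] = x.
Proof.
move=> lT rx /andP[]; rewrite /mask_of !eqnE !look_rk ?size_foldl ?size_ind //.
rewrite !setof_foldl ?size_ind // setof_empty set0U indK; last first.
  by apply/subsetP => a _; apply: ms.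
move=> /eqP rT /eqP rU; rewrite (cl_rk_eq (subsetUr x _)) ?rU //.
by rewrite -(cl_rk_eq (subsetUl _ _)) ?cl_flat // rU.
Qed.

(** A dependent word vanishes, and an independent one is equal to the word of
the relation for its closure. *)
Lemma layer_closedP k es l : (k < r)%N -> size l = k -> layer_closed t r fl k es ->
  vec M (wf R M (None :: lword l)) \in C_zero R M k.+1.
Proof.
move=> ltk sl /orP[cst|/andP[/allP esP cov]].
  have [s0 s0P] : exists s0, forall m, m \in layer t fl (r - k.+1) ->
      size (raises t m) = s0.
    case: (layer _ _ _) cst => [|m0 l0] /=; first by exists 0%N.
    move/allP=> cst.
    exists (size (raises t m0)) => m; rewrite inE => /predU1P[->//|ml].
    by exact/eqP/cst/map_f.
  pose F := wf R M (lword l).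
  rewrite (_ : vec M _ = s0%:R^-1 *: \sum_a vec M (step M a F)); last first.
    apply/ffunP => x; rewrite !ffunE sum_ffunE /= /avg -/F.
    under [in RHS]eq_bigr do rewrite ffunE.
    rewrite -mulr_sumr -[RHS]/(_ * _) [RHS]mulrCA; congr (_ * _).
    have [rx|rx] := eqVneq (rk M x) (r - k.+1)%N.
      rewrite -(s0P (ind s x)) ?mem_layer_ind ?rx // size_raises ?size_ind //.
      by rewrite indK 1?mulrC //; apply/subsetP => a _; apply: ms.
    rewrite big1 ?mul0r ?mulr0 // => a _; apply: contra_neq_eq rx.
    apply: step_rank => Y /wf_rank; rewrite size_map sl; lia.
  apply/memvZ/memv_suml => a _; rewrite -sl; exact: (C_zero_mem R M (a :: l)).
have [rA|rA] := eqVneq (rk M [set a in l]) k; last first.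
  rewrite (_ : vec M _ = 0) ?mem0v //; apply/ffunP => x; rewrite !ffunE /= /avg.
  rewrite big1 ?mul0r ?mulr0 // => a _; rewrite /step; case: ifP => // _.
  rewrite wf_lword; case: andP => // -[/eqP rx /eqP rU]; case/eqP: rA.
  have := rk_setU_leq M (a |: x) [set a in l]; rewrite rU -rx sl leq_add2l => le1.
  apply/eqP; rewrite eqn_leq le1 andbT -sl.
  by apply: leq_trans (rk_leq_card M _) _; rewrite cardsE card_size.
have /hasP[[T [|[w x] c]] /esP //=] : has
    (fun e => same_closure t k (ind s (cl M [set a in l])) e.1) es.
  by apply: (allP cov); rewrite mem_layer_ind rk_cl rA.
case/and5P=> /eqP ew lT /eqP sT x0 /andP[cP rel].
move/(same_closureP lT (etrans (rk_cl M _) rA)) => eT.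
have eF X : wf R M (lword l) X = wf R M (lword (map el T)) X.
  rewrite !wf_lword !size_map sT sl; congr ((_ && (_ == _))%:R).
  by rewrite -rk_clU -[in RHS]rk_clU eT.
have -> : vec M (wf R M (None :: lword l)) = vec M (wf R M (letter_word w)).
  apply/ffunP => y; rewrite !ffunE ew /= -/(letter_word _) letter_lword /avg.
  congr (_ * (_ / _)); apply: eq_bigr => a _; rewrite /step; case: ifP => //.
have := relationP ltk _ rel; rewrite big_cons => /=.
rewrite ew /= letters_lword lT size_map sT eqxx /=.
have -> : all (fun p : word * Z => letters p.1 && (size p.1 == k.+1)) c.
  by apply: sub_all cP => p /and3P[_ -> ->].
move/(_ isT)/eqP; rewrite addr_eq0 => /eqP.
set y := _ * _; set v := vec M _ => ev.
have y0 : y != 0 by rewrite mulf_neq0 ?expf_neq0 // toR_eq0.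
rewrite -[v]scale1r -(mulVf y0) -scalerA ev memvZ // memvN big_seq memv_suml // => p.
move/(allP cP)/and3P=> [sp lp /eqP szp]; apply: memvZ.
have [T' eT'] : exists l', letter_word p.1 = lword l'.
  elim: p.1 sp {lp szp} => [|[i|] w' IH] //=; first by exists [::].
  by case/IH=> l' e; exists (el i :: l'); rewrite /letter_word /= -/(letter_word w') e.
have := C_zero_mem R M T'; rewrite -eT'.
by rewrite -(size_map Some T') -/(lword T') -eT' size_letter_word szp.
Qed.

Lemma averages_commuteP ess : averages_commute t r fl ess ->
  forall k, (k <= r)%N -> C_beta R M k = C_zero R M k.
Proof.
move=> /allP cP; apply: C_beta_eq_zero => l ltl.
by apply: (layer_closedP ltl (erefl _)); apply: cP; rewrite mem_iota.
Qed.

Lemma coef_H_beta k : (k <= r)%N -> (H_beta R M)`_k = (h_beta R M k)%:Z.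
Proof.
move=> le_k; rewrite /H_beta -(poly_def _ (fun k => (h_beta R M k)%:Z)).
by rewrite coef_poly ltnS le_k.
Qed.

Lemma coef_H_zero k : (k <= r)%N -> (H_zero R M)`_k = (h_zero R M k)%:Z.
Proof.
move=> le_k; rewrite /H_zero -(poly_def _ (fun k => (h_zero R M k)%:Z)).
by rewrite coef_poly ltnS le_k.
Qed.

Lemma verdictP c : cert_ok t c -> (H_beta R M != H_zero R M) = escapes c /\
  (~~ escapes c -> forall k, (k <= r)%N -> C_beta R M k = C_zero R M k).
Proof.
case/and5P=> _ _ _; rewrite look_full /escapes; case: (verdict c) => [ess|[T z]].
  move=> /averages_commuteP eC _; split; last by move=> _; apply: eC.
  apply/negbTE; rewrite negbK.
  apply/eqP/eq_bigr => k _; rewrite /h_beta /h_zero eC //.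
  by rewrite -ltnS.
move=> /averages_escapeP[ltT lt_h] _; split=> //; apply: contraTneq lt_h => eH.
have := coef_H_beta ltT; rewrite eH coef_H_zero // => -[->].
by rewrite ltnn.
Qed.

Lemma upP c k : cert_ok t c -> (k <= r)%N -> (h_beta R M k <= up t r fl c k)%N.
Proof.
move=> okc le_k; have [_ eC] := verdictP okc.
case/and5P: okc; rewrite look_full => r1 _ zok _ _; rewrite /up.
set u1 := (_ - _)%N.
have le1 : (h_beta R M k <= u1)%N.
  rewrite /u1; case: (eqVneq k (r - 2)%N) => [ek|_].
    by rewrite ek; apply: upper_okP; rewrite ?leq_subr.
  exact: (@upper_okP k [::]).
set u2 := (if k == 1%N then _ else _).
have le2 : (h_beta R M k <= u2)%N.
  rewrite /u2; case: (eqVneq k 1%N) => [k1|//]; rewrite leq_min le1 k1.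
  rewrite (leq_trans (h_beta1_leq _ _)) ?(ltnW r1) // ltnS -ss -(card_uniqP us).
  by apply/subset_leq_card/subsetP => a _; apply: ms.
case: ifP => // /negbT /eC eCk; rewrite leq_min le2 /h_beta eCk //.
by rewrite -card_layer; apply: h_zero_leq.
Qed.

Lemma lowP c k : cert_ok t c -> (k < r)%N -> (low c k <= h_beta R M k)%N.
Proof.
case/and5P=> _; rewrite look_full => /allP lok _ _ _ ltk.
by apply: lower_okP (ltnW ltk) (lok _ _); rewrite mem_iota.
Qed.

Lemma cert_okP c : cert_ok t c ->
  [/\ forall k, (1 <= k <= r - 1)%N ->
        (h_beta R M (k - 1) * h_beta R M (k + 1) < h_beta R M k ^ 2)%N,
      forall k, (2 * k <= r)%N -> (h_beta R M (r - k) <= h_beta R M k)%N &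
      (H_beta R M != H_zero R M) = escapes c].
Proof.
move=> okc; have [eH eC] := verdictP okc.
have U k := upP (k := k) okc; have L k := lowP (k := k) okc.
case/and5P: okc; rewrite look_full => r1 _ _ _ /andP[/allP lc sym]; split=> // k.
  move=> k1r; have := lc k; rewrite mem_iota => /(_ ltac:(lia)) lck.
  rewrite subn1 addn1.
  apply: leq_ltn_trans (leq_mul (U k.-1 _) (U k.+1 _)) _; try lia.
  by apply: leq_trans lck _; rewrite -mulnn leq_mul // L; lia.
move=> le_k; have [escc|nesc] := boolP (escapes c); last first.
  by rewrite /h_beta !eC ?leq_subr //; try lia; rewrite -!/(h_zero _ _ _) h_zero_sym //; lia.
have [ltk|] := ltnP k (r - k); last first.
  by move=> le2; have -> : (r - k)%N = k by lia.
move: sym; rewrite escc => /allP/(_ k); rewrite mem_iota => /(_ ltac:(lia)).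
rewrite ltk => le_ul; apply: leq_trans (U _ (leq_subr _ _)) _.
by apply: leq_trans le_ul (L _ _); lia.
Qed.

End Soundness.

(** * The catalogue *)

(** The lists and their certificates are found by search and stored as explicit
values; only the certificates are used in proofs. *)

Fixpoint normalize (t : tree nat) : tree nat :=
  if t is Node a b then node (normalize a) (normalize b) else t.

Fixpoint distinct (l : seq N) : bool :=
  if l is x :: l' then ~~ has (N.eqb x) l' <&&> distinct l' else true.

Fixpoint chunks A (fuel : nat) (l : seq A) : seq (seq A) :=
  if fuel is f.+1 then
    if l is [::] then [::] else take 32 l :: chunks f (drop 32 l)
  else [::].

Definition successors n (cat : seq (tree nat)) : seq (tree nat * N) :=
  [seq (u, invariant n.+1 u)
  | u <- flatten [seq [seq normalize (extend t d) | d <- free_extensions n t] | t <- cat]].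

Definition representatives (l : seq (tree nat * N)) : seq (tree nat * N) :=
  foldr (fun p l' => if has (fun q => N.eqb p.2 q.2) l' then l' else p :: l') [::] l.

Definition next_catalogue n (cat : seq (tree nat)) : seq (seq (tree nat)) :=
  chunks 32 (map fst (representatives (successors n cat))).

(** The value at a subset is the sum of the function over its supersets.  The
sums over the supersets of a partial image are compared in [search], so as to
discard early the relabellings that cannot be completed. *)
Fixpoint upper_sums n (t : tree nat) : tree N :=
  if n is n'.+1 then
    let a := upper_sums n' (lo t) in
    let b := upper_sums n' (hi t) in
    Node (map2 N.add a b) b
  else Leaf (N.of_nat (look t [::])).

Fixpoint search n (ps : seq (tree N * tree N)) : option (seq nat) :=
  if n is n'.+1 then
    (fix try k :=
      if k is i.+1 then
        if all (fun p => N.eqb (look (pull1 i p.1) [::]) (look (hi p.2) [::])) ps then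
          if search n' (flatten [seq [:: (pull0 i p.1, lo p.2); (pull1 i p.1, hi p.2)] | p <- ps])
            is Some sg then Some (i :: sg) else try i
        else try i
      else None) n
  else Some [::].

Fixpoint locate (x : N) (l : seq (N * tree N)) k : nat * tree N :=
  if l is p :: l' then if N.eqb x p.1 then (k, p.2) else locate x l' k.+1
  else (k, Leaf 0%num).

Definition certify n (l : seq (N * tree N)) (u : tree nat) : certificate :=
  let: (k, v) := locate (invariant n u) l 0 in
  (k %/ 32, k %% 32, odflt [::] (search n [:: (upper_sums n u, v)])).

Definition certificates n cat next : seq (seq certificate) :=
  let l := [seq (invariant n.+1 u, upper_sums n.+1 u) | u <- flatten next] in
  [seq [seq certify n.+1 l (extend t d) | d <- free_extensions n t] | t <- cat].

(** ** The lists of simple matroids on at most eight elements *)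

Definition cat0 : seq (tree nat) := [:: Leaf 0].
Definition cat1 := Eval vm_compute in next_catalogue 0 cat0.
Definition cat2 := Eval vm_compute in next_catalogue 1 (flatten cat1).
Definition cat3 := Eval vm_compute in next_catalogue 2 (flatten cat2).
Definition cat4 := Eval vm_compute in next_catalogue 3 (flatten cat3).
Definition cat5 := Eval vm_compute in next_catalogue 4 (flatten cat4).
Definition cat6 := Eval vm_compute in next_catalogue 5 (flatten cat5).
Definition cat7 := Eval vm_compute in next_catalogue 6 (flatten cat6).
Definition cat8 := Eval vm_compute in next_catalogue 7 (flatten cat7).
Definition cs0 := Eval vm_compute in certificates 0 cat0 cat1.
Definition cs1 := Eval vm_compute in certificates 1 (flatten cat1) cat2.
Definition cs2 := Eval vm_compute in certificates 2 (flatten cat2) cat3.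
Definition cs3 := Eval vm_compute in certificates 3 (flatten cat3) cat4.
Definition cs4 := Eval vm_compute in certificates 4 (flatten cat4) cat5.
Definition cs5 := Eval vm_compute in certificates 5 (flatten cat5) cat6.
Definition cs6 := Eval vm_compute in certificates 6 (flatten cat6) cat7.
Definition cs7 := Eval vm_compute in certificates 7 (flatten cat7) cat8.

Lemma complete0 : complete 0 cat0.
Proof.
move=> E M s _ us /size0nil ->; exists [::], (Leaf 0); split=> // A sA.
have -> : A = set0 by apply/setP => x; rewrite inE; apply/negbTE/negP => /(subsetP sA).
apply/esym/eqP.
by rewrite -leqn0 (leq_trans (rk_leq_card M _)) ?cards0.
Qed.

Notation catalogue := (flatten cat8).

Lemma complete1 : complete 1 (flatten cat1).
Proof. by apply: (@step_complete 0 cat0 cat1 cs0 complete0); vm_compute. Qed.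

Lemma complete2 : complete 2 (flatten cat2).
Proof. by apply: (@step_complete 1 (flatten cat1) cat2 cs1 complete1); vm_compute. Qed.

Lemma complete3 : complete 3 (flatten cat3).
Proof. by apply: (@step_complete 2 (flatten cat2) cat3 cs2 complete2); vm_compute. Qed.

Lemma complete4 : complete 4 (flatten cat4).
Proof. by apply: (@step_complete 3 (flatten cat3) cat4 cs3 complete3); vm_compute. Qed.

Lemma complete5 : complete 5 (flatten cat5).
Proof. by apply: (@step_complete 4 (flatten cat4) cat5 cs4 complete4); vm_compute. Qed.

Lemma complete6 : complete 6 (flatten cat6).
Proof. by apply: (@step_complete 5 (flatten cat5) cat6 cs5 complete5); vm_compute. Qed.

Lemma complete7 : complete 7 (flatten cat7).
Proof. by apply: (@step_complete 6 (flatten cat6) cat7 cs6 complete6); vm_compute. Qed.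

Lemma complete8 : complete 8 (flatten cat8).
Proof. by apply: (@step_complete 7 (flatten cat7) cat8 cs7 complete7); vm_compute. Qed.

Lemma size_catalogue : size catalogue = 950.
Proof. by vm_compute. Qed.

Lemma catalogue_valid : all (valid 8) catalogue.
Proof. by vm_compute. Qed.

Lemma catalogue_distinct : distinct (map (invariant 8) catalogue).
Proof. by vm_compute. Qed.

(** * Searching for certificates *)

Fixpoint subsets (l : seq nat) k : seq (seq nat) :=
  match l, k with
  | _, 0 => [:: [::]]
  | [::], _ => [::]
  | x :: l', k'.+1 => map (cons x) (subsets l' k') ++ subsets l' k
  end.

(** These words with at most one average, or two averages for [k = 2], span
enough; commuting letters are listed once. *)
Definition candidates k : seq word :=
  let f j := map lword_of (subsets (iota 0 8) j) in
  f k ++ match k with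
  | 0 => [::]
  | 1 => [:: [:: None]]
  | k1.+1 => map (cons None) (f k1) ++
    (if k is 2 then [:: [:: None; None]] else [::]) ++
    flatten [seq [seq [:: Some a, None & w] | a <- iota 0 8] | w <- f k1.-1]
  end.

Definition primitive (v : seq Z) : seq Z :=
  let g := foldr Z.gcd Z0 v in
  if isZ0 g then v else [seq Z.div x g | x <- v].

Definition cancel p (v w : seq Z) : seq Z :=
  let x := nth Z0 v p in let y := nth Z0 w p in
  if isZ0 y then w else primitive (combine x y v w).

Definition reduce (basis : seq (nat * seq Z)) (w : seq Z) : seq Z :=
  foldl (fun w b => cancel b.1 b.2 w) w basis.

Fixpoint smallest i (best : Z) (bi : option nat) (v : seq Z) : option nat :=
  if v is x :: v' then
    if isZ0 x then smallest i.+1 best bi v'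
    else if (if bi is None then true else Z.ltb (Z.abs x) (Z.abs best))
      then smallest i.+1 x (Some i) v' else smallest i.+1 best bi v'
  else bi.

Fixpoint select (cap : nat) (basis : seq (nat * seq Z))
    (rows : seq (word * seq Z)) : seq (word * nat) :=
  if rows is (w, v) :: rows' then
    if cap is cap'.+1 then
      let v' := primitive (reduce basis v) in
      if smallest 0 Z0 None v' is Some p
      then (w, p) :: select cap' (rcons basis (p, v')) rows'
      else select cap basis rows'
    else [::]
  else [::].

(** As many independent words in each length as the inequalities require. *)
Definition caps r : seq nat := nth [::]
  [:: [::]; [::]; [:: 8]; [:: 8; 4]; [:: 8; 9; 6]; [:: 8; 28; 22; 6];
      [:: 9; 28; 50; 23; 6]; [:: 8; 22; 40; 40; 22; 6];
      [:: 8; 22; 45; 57; 45; 22; 6]] r.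

Definition find_lower t r fl k : seq word * seq mask :=
  let ms := layer t fl (r - k) in
  let ws := select (nth 1 (1 :: caps r) k) [::]
    [seq (w, [seq value t r w m | m <- ms]) | w <- candidates k] in
  (map fst ws, [seq nth [::] ms p.2 | p <- ws]).

Definition unit_vector n i : seq Z := mkseq (fun j => if j == i then (Zpos xH) else Z0) n.

(** Each row carries, after its first [len] entries, its expression in the rows
of the start. *)
Fixpoint find_relation len (basis : seq (nat * seq Z)) row (vs : seq (seq Z)) :=
  if all isZ0 (take len row) then Some (drop len row) else
  if vs is v :: vs' then
    let v' := primitive (reduce basis v) in
    if smallest 0 Z0 None (take len v') is Some p
    then find_relation len (rcons basis (p, v')) (cancel p v' row) vs'
    else find_relation len basis row vs'
  else None.

(** A vanishing combination of [row] and of the rows [vs]. *)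
Definition dependency (row : seq Z) (vs : seq (seq Z)) : option (seq Z) :=
  let n := (size vs).+1 in
  find_relation (size row) [::] (row ++ unit_vector n 0)
    [seq p.1 ++ unit_vector n p.2 | p <- zip vs (iota 1 n)].

Definition nonzero T (l : seq (T * Z)) := [seq p <- l | ~~ isZ0 p.2].

Definition find_duals t r fl (ws : seq word) k : seq dual :=
  let ms := layer t fl (r - k) in
  let vs := [seq [seq value t r w m | w <- ws] | m <- ms] in
  pmap (fun j => if dependency (nth [::] vs j) (take j vs) is Some c
    then Some (nonzero (zip (nth [::] ms j :: take j ms) c)) else None)
    (iota 0 (size ms)).

Definition find_basis t (m : mask) : seq nat :=
  (foldl (fun p i => if nth false m i && (look t p.1 < look t (setb p.1 i))
     then (setb p.1 i, rcons p.2 i) else p) (empty_mask, [::]) (iota 0 8)).2.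

Definition find_entry t r fl k (m : mask) : seq nat * relation :=
  let ms := layer t fl (r - k.+1) in
  let T := find_basis t m in
  let row w := [seq value t r w m' | m' <- ms] in
  let try ws := if dependency (row (None :: lword_of T)) (map row ws) is Some c
    then Some (nonzero (zip ((None :: lword_of T) :: ws) c)) else None in
  let near := [seq lword_of (rcons T a) | a <- iota 0 8 & look t m < look t (setb m a)] in
  let far := near ++ [seq lword_of (find_basis t m') | m' <- layer t fl k.+1] in
  (T, if try near is Some c then c else odflt [::] (try far)).

Definition find_relations t r fl : seq (seq (seq nat * relation)) :=
  [seq let ms := layer t fl (r - k.+1) in
       if constant [seq size (raises t m) | m <- ms] then [::]
       else [seq find_entry t r fl k m | m <- layer t fl k] | k <- iota 0 r].

Definition find_escapes t r fl (Ts : seq (seq nat)) k : seq (seq nat * dual) :=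
  flatten [seq [seq (T, z) | T <- Ts & ~~ isZ0 (apply_dual t r z (None :: lword_of T))]
          | z <- find_duals t r fl (words atoms k) k].

(** In most cases already the average of the empty word, a constant on the flats
of rank [r - 1], escapes the commuting part; otherwise the average of one letter
is tried. *)
Definition find_verdict t r fl :=
  if find_escapes t r fl [:: [::]] 1 is e :: _ then inr e else
  let ess := find_relations t r fl in
  if averages_commute t r fl ess then inl ess
  else inr (head ([::], [::]) (find_escapes t r fl [seq [:: a] | a <- iota 0 8] 2)).

Definition inequalities_ok t c : bool :=
  let r := look t full_mask in
  let fl := flat_masks t in
  all (fun k => up t r fl c k.-1 * up t r fl c k.+1 < low c k * low c k) (iota 1 (r - 1))
  && (escapes c ==> all (fun k => (k < r - k) ==> (up t r fl c (r - k) <= low c k)) (iota 0 r)).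

Definition find_cert (t : tree nat) : cert :=
  let r := look t full_mask in
  let fl := flat_masks t in
  let c := Cert [seq find_lower t r fl k | k <- iota 0 r] [::] (find_verdict t r fl) in
  if inequalities_ok t c then c
  else
    let zs := find_duals t r fl (candidates (r - 2)) (r - 2) in
    head c [seq c' <- [seq Cert (lowers c) (take n zs) (verdict c) | n <- iota 0 (size zs).+1]
           | inequalities_ok t c'].

Definition certs := Eval vm_compute in map find_cert catalogue.

(** * The final count *)

Lemma certs_ok : all2 cert_ok catalogue certs.
Proof. by vm_compute. Qed.

Lemma count_escapes : count escapes certs = 894.
Proof. by vm_compute. Qed.

Lemma distinct_inj (l : seq N) i j : distinct l -> i < size l -> j < size l ->
  nth 0%num l i = nth 0%num l j -> i = j.
Proof.
elim: l i j => [//|x l IH] [|i] [|j] //= /andP[/hasPn xl dl] lti ltj e.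
- by have := xl _ (mem_nth 0%num ltj); rewrite -e N.eqb_refl.
- by have := xl _ (mem_nth 0%num lti); rewrite e N.eqb_refl.
by rewrite (IH i j).
Qed.

Lemma all2_nth S T (p : S -> T -> bool) x0 y0 s t i :
  all2 p s t -> i < size s -> p (nth x0 s i) (nth y0 t i).
Proof.
by elim: s t i => [|x s IH] [|y t] [|i] //= /andP[pxy pst]; [|apply: IH].
Qed.

Lemma all2_size S T (p : S -> T -> bool) s t : all2 p s t -> size s = size t.
Proof. by elim: s t => [|x s IH] [|y t] //= /andP[_ /IH->]. Qed.

Section Assembly.
Variables (R : realFieldType) (cat : seq (tree nat)) (cs : seq cert).
Hypotheses (catC : complete 8 cat) (cat_valid : all (valid 8) cat).
Hypotheses (cat_distinct : distinct (map (invariant 8) cat)).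
Hypothesis cs_ok : all2 cert_ok cat cs.

Lemma listing (E : finType) (M : matroid E) : #|E| = 8 -> simple_matroid M ->
  exists s t, [/\ uniq s, forall x, x \in s, size s = 8, t \in cat &
    forall A, ev s t A = rk M A].
Proof.
move=> cE simM.
have [|s [t [ps tcat _ tE]]] := catC (s := enum E) simM (enum_uniq _).
  by rewrite -cardE.
have ms x : x \in s by rewrite (perm_mem ps) mem_enum.
exists s, t; split=> // [||A].
- by rewrite (perm_uniq ps) enum_uniq.
- by rewrite (perm_size ps) -cardE.
by apply: tE; apply/subsetP => x _; rewrite mem_enum.
Qed.

Lemma inequalities (E : finType) (M : matroid E) : #|E| = 8 -> simple_matroid M ->
  (forall k, 1 <= k <= matroid_rank M - 1 ->
    h_beta R M (k - 1) * h_beta R M (k + 1) < h_beta R M k ^ 2) /\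
  (forall k, 2 * k <= matroid_rank M -> h_beta R M (matroid_rank M - k) <= h_beta R M k).
Proof.
move=> cE simM; have [s [t [us ms ss tcat tE]]] := listing cE simM.
have [e0 _] : exists x, x \in E by apply/card_gt0P; rewrite cE.
pose c0 := Cert [::] [::] (inl [::]).
have := all2_nth t c0 cs_ok (etrans (index_mem _ _) tcat).
by rewrite nth_index // => /(cert_okP R e0 us ms ss tE)[].
Qed.

Lemma nth_valid i : i < size cat -> valid 8 (nth (Leaf 0) cat i).
Proof. exact/all_nthP. Qed.

Definition entry (i : 'I_(size cat)) : matroid 'I_8 := valid_matroid (nth_valid (ltn_ord i)).

Lemma entry_inj i j : matroid_iso (entry i) (entry j) -> i = j.
Proof.
move/rank_invariant_iso.
have E k : rank_invariant (entry k) = nth 0%num (map (invariant 8) cat) k.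
  rewrite (nth_map (Leaf 0)) //; rewrite -[X in invariant X]size_s8.
  apply/esym/invariantE; [exact: s8_uniq|exact: mem_s8|].
  by move=> A; rewrite rk_valid_matroid.
by rewrite !E => e; apply/val_inj/(distinct_inj cat_distinct); rewrite ?size_map ?(valP i) ?(valP j).
Qed.

Lemma entry_complete (E : finType) (M : matroid E) : #|E| = 8 -> simple_matroid M ->
  exists i, matroid_iso M (entry i).
Proof.
move=> cE simM; have [s [t [us ms ss tcat tE]]] := listing cE simM.
have lti : index t cat < size cat by rewrite index_mem.
exists (Ordinal lti); apply: (same_tree_iso us ms s8_uniq mem_s8 _ tE).
  by rewrite ss size_s8.
by move=> A; rewrite rk_valid_matroid /= nth_index.
Qed.

Lemma card_entries :
  #|[set i | H_beta R (entry i) != H_zero R (entry i)]| = count escapes cs.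
Proof.
pose c0 := Cert [::] [::] (inl [::]).
rewrite -sum1_count (big_nth c0) -(all2_size cs_ok) big_mkord -sum1_card.
apply: eq_bigl => i; rewrite inE.
have okc := all2_nth (Leaf 0) c0 cs_ok (ltn_ord i).
have [_ _ ->] := cert_okP R (M := entry i) ord0 s8_uniq mem_s8 size_s8
  (fun A => esym (rk_valid_matroid (nth_valid (ltn_ord i)) A)) okc.
by [].
Qed.

End Assembly.

Local Open Scope ring_scope.

Theorem proposition5p1 (R : realType) :
  (* the inequalities, for every simple matroid on eight elements *)
  (forall (E : finType) (M : matroid E), #|E| = 8%N -> simple_matroid M ->
    (forall k : nat, (1 <= k <= matroid_rank M - 1)%N ->
      (h_beta R M (k - 1) * h_beta R M (k + 1) < h_beta R M k ^ 2)%N) /\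
    (forall k : nat, (2 * k <= matroid_rank M)%N ->
      (h_beta R M (matroid_rank M - k) <= h_beta R M k)%N)) /\
  (* the catalogue: complete, without repetition up to isomorphism *)
  (exists cat : 'I_950 -> matroid 'I_8,
    [/\ forall i, simple_matroid (cat i),
        forall i j, matroid_iso (cat i) (cat j) -> i = j,
        forall (E : finType) (M : matroid E), #|E| = 8%N -> simple_matroid M ->
          exists i, matroid_iso M (cat i)
      & #|[set i | H_beta R (cat i) != H_zero R (cat i)]| = 894%N]).
Proof.
split; first exact: (inequalities R complete8 certs_ok).
move: size_catalogue certs_ok catalogue_distinct catalogue_valid complete8.
move: catalogue count_escapes => l esc sl cs_ok dist val comp.
rewrite -sl; exists (entry val); split.
- by move=> i; apply: valid_matroid_simple.
- exact: entry_inj.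
- exact: entry_complete.
by rewrite (card_entries R val cs_ok).
Qed.
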